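(* Let $A$ be a finite abelian group, $g\in\mathrm{Aut}(A)$, and $(A,g)$ the corresponding affine crossed set, $x\triangleright y=x+g(y-x)$. In parts (1), (3), (4) let $(V=\mathbb CA,c^{\mathfrak q})$ be the braided vector space with constant cocycle $\mathfrak q\equiv-1$. (1) Let $x_1,x_2\in A$. Define inductively $x_i\in A$ ($i\ge3$) by $x_i=x_{i-1}\triangleright x_{i-2}$. Let $n$ be the minimum positive integer such that $x_2-x_1\in\ker\sum_{i=0}^{n-1}(-g)^i$. Then in $\mathfrak B(V)$ we have the relation $$x_2x_1+x_3x_2+\cdots+x_nx_{n-1}+x_1x_n=0$$ (for $n=1$, i.e. $x_1=x_2$, this reads $x_1x_1=0$). Furthermore, taking different pairs $(x_2,x_1)$, this is a basis of the relations in degree $2$. In other words, consider on $A\times A$ the relation $(x_2,x_1)\sim(a,b)$ if there exists $m\in\mathbb N$ such that $(a,b)=(x_m,x_{m-1})$, where the $x_i$'s ($i\ge3$) are defined inductively from the given $x_1,x_2$ by $x_i=x_{i-1}\triangleright x_{i-2}$. Then $\sim$ is an equivalence relation, and the dimension of the space of relations of $\mathfrak B(V)$ in degree $2$ (i.e. the kernel of the multiplication $V\otimes V\to\mathfrak B(V)$) coincides with the number of equivalence classes $|A\times A/\sim|$. (2) If instead $\mathfrak q\equiv q$ is constant, where $-q$ is a primitive $\ell$-th root of unity, then the relations in degree $2$ are the chains $$x_2x_1+(-q)x_3x_2+(-q)^2x_4x_3+\cdots+(-q)^{n-1}x_1x_n$$ such that $\ell\mid n$, where the elements $x_i\in A$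 and $n\in\mathbb N$ are defined as in part (1). (3) If $x,y\in A$ satisfy $(1-g+g^2-g^3)(x-y)=0$, then in $\mathfrak B(V)$ we have the relation $$xyxy+yxyx=0.$$ The element $xyxy+yxyx$ is homogeneous with respect to the $\mathrm{Inn}_\triangleright(A)$-grading. Furthermore, in the algebra $\widehat{\mathfrak B}_2(V)$ the element $xyxy+yxyx$ is primitive. In other words, if $Q\supseteq\ker Q_2$ is an $\mathrm{Inn}_\triangleright(A)$-homogeneous coideal of $T(V)$, then the ideal generated by $Q+\mathbb C(xyxy+yxyx)$ is also an $\mathrm{Inn}_\triangleright(A)$-homogeneous coideal. (4) If $x,y,z\in A$ satisfy $(1-g+g^2)(x-z)=(1-g+g^2)(y-z)=0$, then in $\mathfrak B(V)$ we have the relation $$xyzxyz+yzxyzx+zxyzxy=0.$$ The element $xyzxyz+yzxyzx+zxyzxy$ is homogeneous with respect to the $\mathrm{Inn}_\triangleright(A)$-grading. Furthermore, in the algebra $\widehat{\mathfrak B}_2(V)$ the element $xyzxyz+yzxyzx+zxyzxy$ is primitive. In other words, if $Q\supseteq\ker Q_2$ is an $\mathrm{Inn}_\triangleright(A)$-homogeneous coideal of $T(V)$, then the ideal generated by $Q+\mathbb C(xyzxyz+yzxyzx+zxyzxy)$ is also an $\mathrm{Inn}_\triangleright(A)$-homogeneous coideal.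
   Context: $\mathbb CA$ denotes the complex vector space with basis the set $A$; products such as $x_2x_1$ of elements of $A$ are products of basis vectors in $T(V)$ or its quotients, whereas $x-y$ etc. inside $\ker$ or under polynomials in $g$ refer to the group $A$. For a constant $q\in\mathbb C^\times$, the braiding is $c^{\mathfrak q}(x\otimes y)=q\,(x\triangleright y)\otimes x$. $\mathrm{Inn}_\triangleright(A)$ is the subgroup of the symmetric group of the set $A$ generated by the maps $\phi_x:y\mapsto x\triangleright y$; $T(V)$ is graded by the group $\mathrm{Inn}_\triangleright(A)$ with $\deg x=\phi_x$ for $x\in A$. $T(V)$ is a graded braided Hopf algebra with elements of $V$ primitive (comultiplication multiplicative with respect to the braided product on $T(V)\otimes T(V)$). Nichols algebra: let the braid group $\mathbb B_n$ (generators $\sigma_i$) act on $V^{\otimes n}$, $\sigma_i$ by the braiding in positions $i,i+1$; for $x\in\mathbb S_n$ with shortest expression $x=\tau_{i_1}\cdots\tau_{i_l}$ in elementary transpositions put $M(x)=\sigma_{i_1}\cdots\sigma_{i_l}$; $Q_n=\sum_{x\in\mathbb S_n}M(x)$ (so $Q_2=1+c$); then $\mathfrak B(V)=\mathbb C\oplus V\oplus\bigoplus_{n\ge2}V^{\otimes n}/\ker Q_n$. $\widehat{\mathfrak B}_2(V)=T(V)/J_2$, where $J_2$ is the ideal generated by $\ker Q_2\subseteq V\otimes V$; it is a braided Hopf algebra quotient of $T(V)$.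
   Formalization: In the ''in other words'' clauses of (3) and (4), ''the ideal generated by'' means the smallest two-sided ideal stable under the braiding; with ordinary ideals the clause fails, e.g. A=Z/3, g=-1, x=y=z=0, Q = ker Q_2 + C·e_0. *)

(* Defs.v *)
From HB Require Import structures.
From mathcomp Require Import all_boot all_order all_algebra all_fingroup.
From mathcomp Require Import zify finmap boolp classical_sets reals.
From mathcomp.multinomials Require Import monalg.
From mathcomp Require Import complex.

Set Implicit Arguments.
Unset Strict Implicit.
Unset Printing Implicit Defensive.

Import GRing.Theory.

Local Open Scope ring_scope.
Local Open Scope classical_set_scope.

Section LinearAlgebra.
Variable F : fieldType.

Definition is_subspace (E : lmodType F) (S : set E) : Prop :=
  S 0 /\ forall (a : F) (u v : E), S u -> S v -> S (a *: u + v).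

Definition lin_span (E : lmodType F) (X : set E) : set E := smallest (@is_subspace E) X.

Definition add_set (E : lmodType F) (X Y : set E) : set E :=
  [set x + y | x in X & y in Y].

Definition lin_indep (E : lmodType F) (s : seq E) : Prop :=
  uniq s /\ forall a : E -> F, \sum_(v <- s) a v *: v = 0 ->
    forall v, v \in s -> a v = 0.

Definition is_basis (E : lmodType F) (S : set E) (s : seq E) : Prop :=
  lin_indep s /\ S = lin_span [set` s].

Definition has_dim (E : lmodType F) (S : set E) (d : nat) : Prop :=
  exists2 s : seq E, is_basis S s & size s = d.

Definition linext (K : choiceType) (E : lmodType F) (h : K -> E)
    (f : {malg F[K]}) : E := \sum_(k <- msupp f) f@_k *: h k.

End LinearAlgebra.

Section AffineRack.
Variables (A : finZmodType) (g : {perm A}).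

Definition affop (x y : A) : A := x + g (y - x).

Lemma affop_inj x : injective (affop x).
Proof. by move=> y z /addrI/perm_inj/addIr. Qed.

Definition phi (x : A) : {perm A} := perm (@affop_inj x).

Definition Inn : {group {perm A}} := <<[set phi x | x : A]%SET>>%G.

(* The degree phi_{x_1} o ... o phi_{x_n} of the word x_1 ... x_n; in
   [{perm A}] the product [(s * t)%g] is [t \o s]. *)
Definition wdeg (w : {fmonom A}) : {perm A} :=
  foldr (fun x s => (s * phi x)%g) 1%g w.

Definition wact (u v : {fmonom A}) : {fmonom A} := FMonom (map (wdeg u) v).

(* x_1, x_2, x_3, ... indexed from 1; the value at 0 is never used. *)
Fixpoint xs (x1 x2 : A) (i : nat) : A :=
  match i with
  | (i''.+1 as i').+1 => if i'' is 0 then x2 else affop (xs x1 x2 i') (xs x1 x2 i'')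
  | _ => x1
  end.

Definition alt_sum (n : nat) (d : A) : A :=
  \sum_(i < n) iter i (fun a => - g a) d.

Lemma alt_sum_ex d : exists n, (0 < n)%N && (alt_sum n d == 0).
Proof.
pose h a := - g a; have h_inj : injective h by move=> a b /oppr_inj/perm_inj.
pose o := fingraph.order h d; have o0 : (0 < o)%N by apply: fingraph.order_gt0.
have it k i : iter (o * k + i) h d = iter i h d.
  elim: k => [|k IH]; first by rewrite muln0.
  by rewrite mulnS -addnA addnC iterD (fingraph.iter_order h_inj).
have S k : alt_sum (o * k) d = alt_sum o d *+ k.
  elim: k => [|k IH]; first by rewrite muln0 /alt_sum big_ord0 mulr0n.
  rewrite mulnS addnC /alt_sum big_split_ord /= -/(alt_sum _ _) IH mulrSr.
  by congr (_ + _); apply: eq_bigr => i _; rewrite it.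
exists (o * #[alt_sum o d]%g)%N; rewrite S muln_gt0 o0 order_gt0 /=.
by rewrite -FinRing.zmodXgE expg_order.
Qed.

(* The least n > 0 such that d lies in the kernel of the sum of the (-g)^i,
   0 <= i < n. *)
Definition chain_len (d : A) : nat := ex_minn (alt_sum_ex d).

(* Pairs are written (x_2, x_1). *)
Definition chain_rel : rel (A * A) := fun p p' =>
  `[< exists m, (2 <= m)%N /\ p' = (xs p.2 p.1 m, xs p.2 p.1 m.-1) >].

Definition chain_classes (D : {set A * A}) : {set {set A * A}} :=
  equivalence_partition chain_rel D.

End AffineRack.

Section ShortestExpressions.
Variable n : nat.

Definition adj (i : 'I_n) : 'S_n.+1 := tperm (widen_ord (leqnSn n) i) (lift ord0 i).

Definition expr_val (s : seq 'I_n) : 'S_n.+1 := (\prod_(i <- s) adj i)%g.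

Definition is_shortest (s : seq 'I_n) (x : 'S_n.+1) : Prop :=
  expr_val s = x /\ forall t, expr_val t = x -> (size s <= size t)%N.

Lemma expr_ex x : exists s, expr_val s = x.
Proof.
pose G := [set x : 'S_n.+1 | `[< exists s, expr_val s = x >]]%SET.
have GP y : reflect (exists s, expr_val s = y) (y \in G).
  by rewrite inE; apply: asboolP.
have G1 : 1%g \in G by apply/GP; exists [::]; rewrite /expr_val big_nil.
have GM y z : y \in G -> z \in G -> (y * z)%g \in G.
  move=> /GP[s <-] /GP[t <-]; apply/GP; exists (s ++ t).
  by rewrite /expr_val big_cat.
have Gt k (i j : 'I_n.+1) : (j = i + k :> nat)%N -> tperm i j \in G.
  elim: k i j => [|k IH] i j ij.
    by rewrite (_ : j = i) ?tperm1 //; apply/val_inj; rewrite /= ij addn0.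
  have jn : (i + k < n)%N by rewrite -ltnS -addnS -ij.
  pose a : 'I_n := Ordinal jn; pose i' : 'I_n.+1 := widen_ord (leqnSn n) a.
  have Ga : adj a \in G.
    by apply/GP; exists [:: a]; rewrite /expr_val big_seq1.
  have ja : j = lift ord0 a by apply/val_inj; rewrite /= ij addnS.
  have [k0|k0] := posnP k.
    rewrite (_ : i = i') ?ja //; apply/val_inj; by rewrite /= k0 addn0.
  have Gi : tperm i i' \in G by apply: IH.
  suff -> : tperm i j = (adj a * (tperm i i' * adj a))%g.
    by apply: (GM) => //; apply: (GM).
  have -> : (adj a * (tperm i i' * adj a) = tperm i i' ^ adj a)%g.
    by rewrite conjgE /adj tpermV.
  have -> : (tperm i i' ^ adj a = tperm (adj a i) (adj a i'))%g by exact: tpermJ.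
  have -> : adj a i' = j by rewrite ja /adj tpermL.
  rewrite /adj tpermD //; apply/eqP => /(congr1 val) /=; last by rewrite /bump /=; lia.
  by move: k0; lia.
have [ts -> _] := prod_tpermP x; apply/GP.
elim: ts => [|t ts IH]; first by rewrite big_nil.
rewrite big_cons; apply: (GM) => //.
have [le|/ltnW le] := leqP t.1 t.2.
  by apply: (Gt (t.2 - t.1)%N); rewrite subnKC.
by rewrite tpermC; apply: (Gt (t.1 - t.2)%N); rewrite subnKC.
Qed.

Lemma shortest_ex x : exists s, is_shortest s x.
Proof.
have ex : exists k, `[< exists2 s, expr_val s = x & size s = k >].
  by have [s sx] := expr_ex x; exists (size s); apply/asboolP; exists s.
case: (ex_minnP ex) => k /asboolP[s sx sk] min.
by exists s; split=> // t tx; rewrite sk; apply: min; apply/asboolP; exists t.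
Qed.

Definition shortest (x : 'S_n.+1) : seq 'I_n := sval (cid (shortest_ex x)).

End ShortestExpressions.

(* The tensor algebra of V = FA is the monoid algebra of the free monoid on A,
   and T(V) (x) T(V) is the vector space with basis the pairs of words. *)
Notation talg F A := {malg F[{fmonom A}]}.
Notation talg2 F A := {malg F[({fmonom A} * {fmonom A})%type]}.

Section TensorAlgebra.
Variables (F : fieldType) (A : finZmodType).

Definition gen (x : A) : talg F A := << FMonom [:: x] >>.

Definition counit (f : talg F A) : F := f@_mone.

Definition tens (f h : talg F A) : talg2 F A :=
  \sum_(u <- msupp f) \sum_(v <- msupp h) (f@_u * h@_v) *: << (u, v) >>.

Definition tens_space (X Y : set (talg F A)) : set (talg2 F A) :=
  lin_span [set tens f h | f in X & h in Y].

Definition wcomp (P : pred {fmonom A}) (f : talg F A) : talg F A :=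
  \sum_(w <- msupp f | P w) f@_w *: << w >>.

Definition ncomp (n : nat) : talg F A -> talg F A := wcomp (fun w => size w == n).

Definition homog_deg (n : nat) (f : talg F A) : Prop :=
  forall w, w \in msupp f -> size w = n.

Definition two_sided_ideal (I : set (talg F A)) : Prop :=
  is_subspace I /\ forall f h, I f -> I (h * f) /\ I (f * h).

(* I (x) T(V) + T(V) (x) I, the kernel of
   T(V) (x) T(V) -> T(V)/I (x) T(V)/I. *)
Definition tens_ker (I : set (talg F A)) : set (talg2 F A) :=
  add_set (tens_space I setT) (tens_space setT I).

Variable g : {perm A}.

Definition Inn_homog_elt (f : talg F A) : Prop :=
  exists2 h, h \in Inn g & forall w, w \in msupp f -> wdeg g w = h.

Definition Inn_homog_space (S : set (talg F A)) : Prop :=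
  is_subspace S /\ forall h, h \in Inn g ->
    forall f, S f -> S (wcomp (fun w => wdeg g w == h) f).

(* x_2x_1 + x_3x_2 + ... + x_nx_{n-1} + x_1x_n, for the pair p = (x_2, x_1). *)
Definition chain (p : A * A) : talg F A :=
  let x i := gen (xs g p.2 p.1 i) in
  let n := chain_len g (p.1 - p.2) in
  \sum_(2 <= i < n.+1) x i * x i.-1 + x 1%N * x n.

Variable q : F.

Definition qchain (p : A * A) : talg F A :=
  let x i := gen (xs g p.2 p.1 i) in
  let n := chain_len g (p.1 - p.2) in
  \sum_(2 <= i < n.+1) (- q) ^+ (i - 2) *: (x i * x i.-1)
  + (- q) ^+ n.-1 *: (x 1%N * x n).

(* sigma_i braids the letters in positions i and i + 1 (counted from 0). *)
Definition sigma (i : nat) : talg F A -> talg F A :=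
  linext (fun w : {fmonom A} =>
    if drop i w is x :: y :: v
    then q *: << FMonom (take i w ++ affop g x y :: x :: v) >>
    else << w >>).

Definition braid_lift (n : nat) (x : 'S_n.+1) : talg F A -> talg F A :=
  foldr (fun (i : 'I_n) h => sigma i \o h) id (shortest x).

(* Q_n acts on the homogeneous component V^{(x) n} of T(V). *)
Definition qsym (n : nat) (f : talg F A) : talg F A :=
  if n is m.+1 then \sum_(x : 'S_m.+1) braid_lift x f else f.

(* The kernel of T(V) -> B(V). *)
Definition nichols_ideal : set (talg F A) :=
  [set f | forall n, qsym n (ncomp n f) = 0].

(* The kernel of V (x) V -> B(V). *)
Definition nichols_rel2 : set (talg F A) :=
  [set f | homog_deg 2 f /\ nichols_ideal f].

Definition kerQ2 : set (talg F A) := [set f | homog_deg 2 f /\ qsym 2 f = 0].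

Definition J2 : set (talg F A) := smallest two_sided_ideal kerQ2.

(* The extension of c^q to T(V) (x) T(V) compatible with products:
   u (x) v |-> q^(|u||v|) phi_u(v) (x) u on words, where phi_u = wdeg u. *)
Definition braid : talg2 F A -> talg2 F A :=
  linext (fun k : {fmonom A} * {fmonom A} =>
    q ^+ (size k.1 * size k.2) *: << (wact g k.1 k.2, k.1) >>).

(* (a (x) b)(a' (x) b') = a c(b (x) a') b'. *)
Definition bmul (s t : talg2 F A) : talg2 F A :=
  \sum_(a <- msupp s) \sum_(b <- msupp t)
    (s@_a * t@_b * q ^+ (size a.2 * size b.1))
      *: << (mmul a.1 (wact g a.2 b.1), mmul a.2 b.2) >>.

Definition comul : talg F A -> talg2 F A :=
  linext (fun w : {fmonom A} =>
    foldr (fun x t => bmul (tens (gen x) 1 + tens 1 (gen x)) t) (tens 1 1) w).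

Definition coideal (S : set (talg F A)) : Prop :=
  is_subspace S /\ forall f, S f -> counit f = 0 /\ tens_ker S (comul f).

(* The class of f in T(V)/I is primitive. *)
Definition primitive_mod (I : set (talg F A)) (f : talg F A) : Prop :=
  tens_ker I (comul f - (tens f 1 + tens 1 f)).

(* Two-sided ideals I with c(T(V) (x) I) contained in I (x) T(V), i.e. stable
   under the operators f |-> u.f with c(u (x) f) = u.f (x) u for u a word.  This
   stability cannot be dropped: the product of 1 (x) u with f (x) 1 is u.f (x) u,
   so a merely two-sided ideal generated by a graded coideal is in general not
   a coideal. *)
Definition braided_ideal (I : set (talg F A)) : Prop :=
  two_sided_ideal I /\ forall t f, I f -> tens_space I setT (braid (tens t f)).

Definition braided_ideal_gen (X : set (talg F A)) : set (talg F A) :=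
  smallest braided_ideal X.

End TensorAlgebra.

Arguments gen F {A} x.
Arguments chain F {A} g p.

(* Main.v *)
From HB Require Import structures.
Require Import Defs.
From mathcomp Require Import all_boot all_order all_algebra all_fingroup.
From mathcomp Require Import finmap boolp classical_sets reals.
From mathcomp.multinomials Require Import monalg.
From mathcomp Require Import complex.
From mathcomp Require Import cyclic zify ring.

Set Implicit Arguments.
Unset Strict Implicit.
Unset Printing Implicit Defensive.

Import GRing.Theory.

Local Open Scope ring_scope.
Local Open Scope classical_set_scope.

(** Write [x |> y] for [affop g x y], [c] for the braiding and [T(V)] for the
    tensor algebra.

    Degree two.  On words of length two, [c] is [q] times the permutation
    [(a, b) |-> (a |> b, a)] of [A * A], so the kernel of [1 + c] splits along
    the orbits of that permutation: along an orbit, the coefficients of an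
    element of the kernel form a geometric sequence of ratio [- q], which
    closes up exactly when [(- q) ^+ n = 1] for the length [n] of the orbit.
    The orbits are the chains, because consecutive differences in a chain are
    multiplied by [- g]: after [n] steps the chain is back at [x_1] when the
    sum of the [(- g)^i], [i < n], kills [x_2 - x_1], and then it is also back
    at [x_2].  This is [qchain_basis], and [chain_basis] for [q = -1].

    Degrees four and six.  For [r = xyxy + yxyx] and for the sextic element
    [r], everything follows from the primitivity of [r] modulo [J2].

    - [r] lies in the Nichols ideal ([primitive_nichols]).  Every permutation
      is in a unique way a permutation that fixes the last place after a cycle
      that carries one letter to the last place, and lengths add up.  As the
      braid lift does not depend on the shortest expression ([matsumoto]),
      the quantum symmetrizer of [r] is the sum, over the permutations that fix
      the last place, of the braid lifts of the product of the two factors of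
      the (n - 1, 1) component of the coproduct ([qsym_last_part]).  Modulo the
      components [r (x) 1] and [1 (x) r], which do not contribute, the coproduct
      lies in the tensor kernel of [J2], and that sum kills [J2 V], since the
      lifts of [x] and [x s_i] add up to the lift of [x] applied to [1 + c]
      in places [i] and [i + 1] ([sum_braid_lift_pair]).

    - Adjoining [r] to a homogeneous coideal [Q] gives a coideal
      ([adjoin_primitive]).  The braided ideal [I] generated by [Q] and [r] is
      obtained from [Q] and [r] by multiplying with letters on both sides
      and by applying the operators [twist x], for which
      [c (x (x) f) = twist x f (x) x].  These operations preserve the set of
      the [f] whose coproduct lies in [I (x) T(V) + T(V) (x) I].  The only
      delicate one is the multiplication by a letter on the right: it braids
      the letter with the right tensor factor, and needs [I] to be stable
      under the parity operator.  If [g] has odd order [N], this operator is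
      the [N]-th power of [twist 0]; if [g] has even order, the parity of a
      word can be read off the linear part of its degree in [Inn g]
      ([parity_inn_comp]).

    - Primitivity is a finite computation.  All letters that occur in the
      coproduct of [r] are integral combinations of [x], [y], ([z]) and their
      images under the powers of [g], so it can be made with letters from a
      free module over a quotient of [Z[g]].  Under the hypothesis on [x], [y],
      ([z]) all orbits there have length dividing four, resp. three.  In
      the second case [J2] contains the elements [aba - bab]: with
      the letter [c = a |> b] and the orbit sum [s = ab + ca + bc] one has
      [aba - bab = s a - b s - c aa + bb c].  So the right tensor factors can be
      compared up to braid moves, and words that contain a square vanish.
      Collecting the coproduct accordingly, the coefficient of each right
      factor turns out to lie in [J2].  For instance the coefficient of [y] for
      [xyxy + yxyx] is [xyx + xcy - yxc - cyc = x s - s c - xxd + dcc] with the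
      letters [c = y |> x], [d = c |> y] and [s = yx + cy + dc + xd].  Such
      expressions are listed in [quartic_half] and [sextic_third], and the
      identities that they certify are checked by evaluation
      ([primitive_certificate]). *)

(** * Linear maps on spaces with a basis *)

Section AdditiveFunctions.
Variables (U V : zmodType) (h : U -> V).
Hypothesis hD : {morph h : x y / x + y}.

Lemma additive_fun0 : h 0 = 0.
Proof. by apply: (addrI (h 0)); rewrite -hD !addr0. Qed.

Lemma additive_funN x : h (- x) = - h x.
Proof. by apply: (addrI (h x)); rewrite -hD !subrr additive_fun0. Qed.

Lemma additive_funMz x (m : int) : h (x *~ m) = h x *~ m.
Proof.
have hMn k : h (x *+ k) = h x *+ k.
  by elim: k => [|k IH]; rewrite ?mulr0n ?additive_fun0 // !mulrSr hD IH.
by case: m => k; rewrite ?hMn // !NegzE !mulrNz additive_funN hMn.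
Qed.

End AdditiveFunctions.

Section LinearExtension.
Variable F : fieldType.

Lemma linear_fun0 (E E' : lmodType F) (h : E -> E') : linear h -> h 0 = 0.
Proof. by move=> /(_ (-1) 0 0); rewrite scaler0 addr0 scaleN1r addNr. Qed.

Lemma linear_sum_fun (E E' : lmodType F) (h : E -> E') (I : Type) (r : seq I)
    (P : pred I) (f : I -> E) : linear h ->
  h (\sum_(i <- r | P i) f i) = \sum_(i <- r | P i) h (f i).
Proof.
move=> lh; apply: (big_morph h) => [u v|]; last exact: linear_fun0.
by have := lh 1 u v; rewrite !scale1r.
Qed.

Lemma linearZ_fun (E E' : lmodType F) (h : E -> E') a u :
  linear h -> h (a *: u) = a *: h u.
Proof. by move=> lh; rewrite -[a *: u]addr0 lh (linear_fun0 lh) addr0. Qed.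

Lemma linearD_fun (E E' : lmodType F) (h : E -> E') u v :
  linear h -> h (u + v) = h u + h v.
Proof. by move=> lh; rewrite -[u]scale1r lh !scale1r. Qed.

Lemma zero_linear (E E' : lmodType F) : linear (fun _ : E => 0 : E').
Proof. by move=> a u v; rewrite scaler0 addr0. Qed.

Lemma linearB_fun (E E' : lmodType F) (h : E -> E') u v :
  linear h -> h (u - v) = h u - h v.
Proof.
by move=> lh; rewrite linearD_fun // -scaleN1r linearZ_fun // scaleN1r.
Qed.

Lemma iter_linear (E : lmodType F) (h : E -> E) n : linear h -> linear (iter n h).
Proof. by move=> lh a u v; elim: n => //= n ->; rewrite lh. Qed.

Lemma add_linear (E E' : lmodType F) (h h' : E -> E') :
  linear h -> linear h' -> linear (fun u => h u + h' u).
Proof. by move=> lh lh' a u v; rewrite lh lh' scalerDr addrACA. Qed.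

Lemma sub_linear (E E' : lmodType F) (h h' : E -> E') :
  linear h -> linear h' -> linear (fun u => h u - h' u).
Proof. by move=> lh lh' a u v; rewrite lh lh' scalerBr opprD addrACA. Qed.

(** Enlarging the index set beyond the support makes [linext] comparable at
    different arguments; linearity follows from it. *)
Lemma linextEw (K : choiceType) (E : lmodType F) (h : K -> E)
    (f : {malg F[K]}) (d : {fset K}) :
  (msupp f `<=` d)%fset -> linext h f = \sum_(k <- d) f@_k *: h k.
Proof.
move=> fd; rewrite /linext (big_fset_incl _ fd) // => k _ /mcoeff_outdom ->.
by rewrite scale0r.
Qed.

Lemma linext_is_linear (K : choiceType) (E : lmodType F) (h : K -> E) :
  linear (linext h).
Proof.
move=> a u v; pose d := (msupp u `|` msupp v)%fset.
have ud : (msupp u `<=` d)%fset by rewrite fsubsetUl.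
have vd : (msupp v `<=` d)%fset by rewrite fsubsetUr.
have wd : (msupp (a *: u + v) `<=` d)%fset.
  by rewrite (fsubset_trans (msuppD_le _ _)) // fsetSU // msuppZ_le.
rewrite !(linextEw h wd, linextEw h ud, linextEw h vd).
rewrite scaler_sumr -big_split; apply: eq_bigr => k _ /=.
by rewrite mcoeffD mcoeffZ scalerDl scalerA.
Qed.

HB.instance Definition _ (K : choiceType) (E : lmodType F) (h : K -> E) :=
  GRing.isLinear.Build F {malg F[K]} E *:%R (linext h) (linext_is_linear h).

Lemma linextU (K : choiceType) (E : lmodType F) (h : K -> E) k :
  linext h << k >> = h k.
Proof.
rewrite /linext msuppU oner_eq0 big_seq_fset1.
by rewrite mcoeffUU scale1r.
Qed.

Lemma malg_linE (K : choiceType) (f : {malg F[K]}) :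
  f = \sum_(k <- msupp f) f@_k *: << k >>.
Proof.
rewrite {1}[f]monalgE; apply: eq_bigr => k _.
by apply/malgP => j; rewrite mcoeffZ !mcoeffU mulrnAr mulr1.
Qed.

Lemma malgUZ (K : choiceType) (a c : F) (k : K) :
  << a * c *g k >> = a *: << c *g k >>.
Proof. by apply/malgP => j; rewrite mcoeffZ !mcoeffU mulrnAr. Qed.

Lemma malg_mulr_scaler (K : monomType) (f h : {malg F[K]}) (a : F) :
  f * (a *: h) = a *: (f * h).
Proof.
rewrite (malgMEw (fsubset_refl (msupp f)) (msuppZ_le a h)) malgME scaler_sumr.
apply: eq_bigr => u _; rewrite scaler_sumr; apply: eq_bigr => v _.
by rewrite mcoeffZ mulrCA malgUZ.
Qed.

End LinearExtension.

(** * Subspaces, words and tensors *)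

Section Subspaces.
Variables (F : fieldType) (E : lmodType F).
Implicit Types (S X : set E).

Lemma subspace0 S : is_subspace S -> S 0. Proof. by case. Qed.

Lemma subspaceZ S a u : is_subspace S -> S u -> S (a *: u).
Proof. by move=> [S0 SS] Su; rewrite -[_ *: _]addr0; apply: SS. Qed.

Lemma subspaceD S u v : is_subspace S -> S u -> S v -> S (u + v).
Proof. by move=> [S0 SS] Su Sv; rewrite -[u]scale1r; apply: SS. Qed.

Lemma subspaceN S u : is_subspace S -> S u -> S (- u).
Proof. by move=> SS Su; rewrite -scaleN1r; apply: subspaceZ. Qed.

Lemma subspaceB S u v : is_subspace S -> S u -> S v -> S (u - v).
Proof. by move=> SS Su Sv; apply: subspaceD => //; apply: subspaceN. Qed.

Lemma subspace_sum S (I : Type) (r : seq I) (P : pred I) (f : I -> E) :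
  is_subspace S -> (forall i, P i -> S (f i)) -> S (\sum_(i <- r | P i) f i).
Proof.
move=> SS Sf; elim/big_ind: _ => //; first exact: subspace0.
by move=> u v; apply: subspaceD.
Qed.

Lemma sub_lin_span X : X `<=` lin_span X.
Proof. exact: sub_smallest. Qed.

Lemma lin_span_subspace X : is_subspace (lin_span X).
Proof.
split=> [S [[S0 _] _] // | a u v Xu Xv S SX].
by case: (SX) => -[_ SS] _; apply: SS; [apply: Xu | apply: Xv].
Qed.

Lemma lin_span_min X S : is_subspace S -> X `<=` S -> lin_span X `<=` S.
Proof. by move=> SS XS; apply: smallest_sub. Qed.

Lemma eq_subspace (E' : lmodType F) (h h' : E -> E') :
  linear h -> linear h' -> is_subspace [set x | h x = h' x].
Proof.
move=> lh lh'; split=> [|a u v /= hu hv]; last by rewrite lh lh' hu hv.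
by rewrite /= (linear_fun0 lh) (linear_fun0 lh').
Qed.

Lemma add_set_subspace X S :
  is_subspace X -> is_subspace S -> is_subspace (add_set X S).
Proof.
move=> XX SS; split=> [|a _ _ [x Xx [y Sy <-]] [x' Xx' [y' Sy' <-]]].
  exists 0; first exact: subspace0.
  by exists 0; [exact: subspace0 | rewrite addr0].
exists (a *: x + x'); first by apply: subspaceD => //; apply: subspaceZ.
exists (a *: y + y'); first by apply: subspaceD => //; apply: subspaceZ.
by rewrite scalerDr addrACA.
Qed.

Lemma add_set_min X Y S :
  is_subspace S -> X `<=` S -> Y `<=` S -> add_set X Y `<=` S.
Proof.
by move=> SS XS YS _ [x Xx [y Yy <-]]; apply: subspaceD; [|apply: XS|apply: YS].
Qed.

Lemma sub_add_setl X S : is_subspace S -> X `<=` add_set X S.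
Proof. by move=> [S0 _] x Xx; exists x => //; exists 0 => //; rewrite addr0. Qed.

Lemma sub_add_setr X S : is_subspace X -> S `<=` add_set X S.
Proof. by move=> [X0 _] x Xx; exists 0 => //; exists x => //; rewrite add0r. Qed.

End Subspaces.

Section Words.
Variables (F : fieldType) (A : finZmodType).
Implicit Types (s t : seq A) (f h : talg F A).

Definition word s : talg F A := << FMonom s >>.

Lemma word_ind (S : set (talg F A)) f :
  is_subspace S -> (forall s, S (word s)) -> S f.
Proof.
move=> SS Sw; rewrite (malg_linE f); apply: subspace_sum => // k _.
by apply: subspaceZ => //; have := Sw k; rewrite /word fmK.
Qed.

Lemma word_lin_eq (E : lmodType F) (h h' : talg F A -> E) :
  linear h -> linear h' -> (forall s, h (word s) = h' (word s)) -> h =1 h'.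
Proof.
move=> lh lh' hh' f.
exact: (word_ind (S := [set f | h f = h' f]) _ (eq_subspace lh lh')).
Qed.

Lemma wordM s t : word s * word t = word (s ++ t).
Proof.
rewrite /word malgM_def fgmulUU mulr1.
by congr << _ >>; apply: fmmulE.
Qed.

Lemma word1 : 1 = word [::].
Proof. by rewrite /word -fmoneE. Qed.

Lemma word_cons x s : word (x :: s) = gen F x * word s.
Proof. by rewrite wordM. Qed.

Lemma word_coef s t : (word s)@_(FMonom t) = (s == t)%:R.
Proof. by rewrite mcoeffU1. Qed.

Lemma tensE f h :
  tens f h = linext (fun u => linext (fun v => << (u, v) >>) h) f.
Proof.
rewrite /tens /linext; apply: eq_bigr => u _; rewrite scaler_sumr.
by apply: eq_bigr => v _; rewrite scalerA.
Qed.

Lemma tens_is_linear f : linear (tens f).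
Proof.
move=> a u v; rewrite !tensE [in RHS]/linext scaler_sumr -big_split.
apply: eq_bigr => k _ /=.
by rewrite linearP scalerDr !scalerA mulrC.
Qed.

HB.instance Definition _ f :=
  GRing.isLinear.Build F (talg F A) (talg2 F A) *:%R (tens f) (tens_is_linear f).

Lemma tens_linr a u v f : tens f (a *: u + v) = a *: tens f u + tens f v.
Proof. exact: tens_is_linear. Qed.

Lemma tens_linl a u v h : tens (a *: u + v) h = a *: tens u h + tens v h.
Proof. by rewrite !tensE; apply: linearP. Qed.

Lemma tens0l h : tens 0 h = 0.
Proof. by rewrite tensE linear0. Qed.

Lemma tensZl a f h : tens (a *: f) h = a *: tens f h.
Proof. by rewrite -[a *: f]addr0 tens_linl tens0l addr0. Qed.

Lemma tens_word s t : tens (word s) (word t) = << (FMonom s, FMonom t) >>.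
Proof. by rewrite tensE !linextU. Qed.

Lemma tens_ind (S : set (talg2 F A)) (t : talg2 F A) :
  is_subspace S -> (forall s s', S (tens (word s) (word s'))) -> S t.
Proof.
move=> SS Sw; rewrite (malg_linE t); apply: subspace_sum => // -[u v] _.
by apply: subspaceZ => //; have := Sw u v; rewrite tens_word !fmK.
Qed.

Lemma tens_lin_eq (E : lmodType F) (h h' : talg2 F A -> E) :
  linear h -> linear h' ->
  (forall s t, h (tens (word s) (word t)) = h' (tens (word s) (word t))) ->
  h =1 h'.
Proof.
move=> lh lh' hh' t.
exact: (tens_ind (S := [set t | h t = h' t]) _ (eq_subspace lh lh')).
Qed.

Lemma wcomp_is_linear (P : pred {fmonom A}) : linear (@wcomp F A P).
Proof.
have wE f : wcomp P f = linext (fun w => if P w then << w >> else 0) f.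
  rewrite /wcomp big_mkcond; apply: eq_bigr => k _.
  by case: (P k); rewrite ?scaler0.
by move=> a u v; rewrite !wE linearP.
Qed.

HB.instance Definition _ (P : pred {fmonom A}) :=
  GRing.isLinear.Build F (talg F A) (talg F A) *:%R (wcomp P) (wcomp_is_linear P).

Lemma wcomp_word (P : pred {fmonom A}) s :
  wcomp P (word s) = if P (FMonom s) then word s else 0.
Proof.
rewrite /wcomp msuppU oner_eq0 big_mkcond big_seq_fset1.
by case: (P _); rewrite // mcoeffUU scale1r.
Qed.

Lemma wcomp_coef (P : pred {fmonom A}) f w :
  (wcomp P f)@_w = if P w then f@_w else 0.
Proof.
rewrite {2}(malg_linE f) /wcomp big_mkcond /= !raddf_sum /=.
case Pw: (P w); last first.
  apply: big1 => k _; case Pk: (P k); rewrite ?mcoeff0 // mcoeffZ mcoeffU.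
  by case: eqP => [kw|_]; rewrite ?mulr0 //; rewrite kw Pw in Pk.
apply: eq_bigr => k _; case Pk: (P k); rewrite // mcoeff0 mcoeffZ mcoeffU.
by case: eqP => [kw|_]; rewrite ?mulr0 //; rewrite kw Pw in Pk.
Qed.

Lemma wcomp_id (P : pred {fmonom A}) f :
  (forall w, w \in msupp f -> P w) -> wcomp P f = f.
Proof.
move=> Pf; apply/malgP => w; rewrite wcomp_coef; case Pw: (P w) => //.
by apply/esym/mcoeff_outdom; apply: contraFN Pw => /Pf.
Qed.

Lemma wcomp_eq0 (P : pred {fmonom A}) f :
  (forall w, w \in msupp f -> ~~ P w) -> wcomp P f = 0.
Proof.
move=> Pf; apply/malgP => w; rewrite wcomp_coef mcoeff0; case Pw: (P w) => //.
by apply/mcoeff_outdom; apply: contraTN Pw => /Pf.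
Qed.

End Words.

(** * The coproduct, one letter at a time *)

Section Coproduct.
Variables (F : fieldType) (A : finZmodType) (g : {perm A}) (q : F).
Implicit Types (f h : talg F A).

(** The operator [f |-> x.f] with [c (x (x) f) = x.f (x) x]. *)
Definition twist (x : A) : talg F A -> talg F A :=
  linext (fun w : {fmonom A} => q ^+ size w *: word F (map (phi g x) w)).

Lemma twist_word x s : twist x (word F s) = q ^+ size s *: word F (map (phi g x) s).
Proof. by rewrite /twist linextU. Qed.

HB.instance Definition _ x := GRing.Linear.on (twist x).

(** The left multiplications by [x (x) 1] and by [1 (x) x] in the braided tensor
    square. *)
Definition left_letter (x : A) : talg2 F A -> talg2 F A :=
  linext (fun k : {fmonom A} * {fmonom A} => tens (gen F x * << k.1 >>) << k.2 >>).

Definition right_letter (x : A) : talg2 F A -> talg2 F A :=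
  linext (fun k : {fmonom A} * {fmonom A} =>
    tens (twist x << k.1 >>) (gen F x * << k.2 >>)).

HB.instance Definition _ x := GRing.Linear.on (left_letter x).
HB.instance Definition _ x := GRing.Linear.on (right_letter x).
HB.instance Definition _ := GRing.Linear.on (@comul F A g q).

Lemma comul_lin a u v :
  comul g q (a *: u + v) = a *: comul g q u + comul g q v.
Proof. exact: linearP. Qed.

Lemma left_letter_lin x a u v :
  left_letter x (a *: u + v) = a *: left_letter x u + left_letter x v.
Proof. exact: linearP. Qed.

Lemma right_letter_lin x a u v :
  right_letter x (a *: u + v) = a *: right_letter x u + right_letter x v.
Proof. exact: linearP. Qed.

Lemma twist_lin x a u v : twist x (a *: u + v) = a *: twist x u + twist x v.
Proof. exact: linearP. Qed.

(** Principle by which the operators on the tensor square, defined on pairs of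
    words, are evaluated on all pure tensors. *)
Lemma tens_lin2_eq (E : lmodType F) (h : talg2 F A -> E)
    (b : talg F A -> talg F A -> E) : linear h ->
  (forall f, linear (b f)) -> (forall f, linear (b^~ f)) ->
  (forall s t, h (tens (word F s) (word F t)) = b (word F s) (word F t)) ->
  forall f f', h (tens f f') = b f f'.
Proof.
move=> lh lb rb hb f f'; apply: (word_lin_eq (h := fun f => h (tens f f')) (h' := b^~ f')).
- by move=> a u v; rewrite tens_linl lh.
- exact: rb.
move=> s; apply: (word_lin_eq (h := fun f' => h (tens (word F s) f'))
  (h' := b (word F s))) => //.
by move=> a u v; rewrite tens_linr lh.
Qed.

Lemma mulr_scaler f a h : f * (a *: h) = a *: (f * h).
Proof. exact: malg_mulr_scaler. Qed.

Lemma mulr_linr f a u v : f * (a *: u + v) = a *: (f * u) + f * v.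
Proof. by rewrite mulrDr mulr_scaler. Qed.

Lemma mulr_linl f a u v : (a *: u + v) * f = a *: (u * f) + v * f.
Proof. by rewrite mulrDl -scalerAl. Qed.

Lemma left_letter_tens x f h : left_letter x (tens f h) = tens (gen F x * f) h.
Proof.
apply: (tens_lin2_eq (b := fun f h => tens (gen F x * f) h))
  => [a u v|u a v w|u a v w|s t].
- exact: left_letter_lin.
- exact: linearP.
- by rewrite mulr_linr tens_linl.
- by rewrite tens_word; apply: linextU.
Qed.

Lemma right_letter_tens x f h :
  right_letter x (tens f h) = tens (twist x f) (gen F x * h).
Proof.
apply: (tens_lin2_eq (b := fun f h => tens (twist x f) (gen F x * h)))
  => [a u v|u a v w|u a v w|s t].
- exact: right_letter_lin.
- by rewrite mulr_linr tens_linr.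
- by rewrite twist_lin tens_linl.
- by rewrite tens_word; apply: linextU.
Qed.

Lemma bmulE (s t : talg2 F A) : bmul g q s t = linext (fun a : {fmonom A} * {fmonom A} =>
  linext (fun b : {fmonom A} * {fmonom A} => q ^+ (size a.2 * size b.1) *:
    << (mmul a.1 (wact g a.2 b.1), mmul a.2 b.2) >>) t) s.
Proof.
rewrite /bmul /linext; apply: eq_bigr => a _; rewrite scaler_sumr.
by apply: eq_bigr => b _; rewrite !scalerA.
Qed.

Lemma tens_genl x :
  tens (gen F x) 1 = tens (word F [:: x]) (word F [::]) :> talg2 F A.
Proof. by congr (tens _ _); apply: word1. Qed.

Lemma tens_genr x :
  tens 1 (gen F x) = tens (word F [::]) (word F [:: x]) :> talg2 F A.
Proof. by congr (tens _ _); apply: word1. Qed.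

Lemma bmulDl s s' t : bmul g q (s + s') t = bmul g q s t + bmul g q s' t.
Proof. by rewrite !bmulE (linearD (linext _)). Qed.

Lemma mmulE s t : mmul (FMonom s) (FMonom t) = FMonom (s ++ t) :> {fmonom A}.
Proof. exact: fmmulE. Qed.

Lemma bmul_word s s' t t' :
  bmul g q (tens (word F s) (word F s')) (tens (word F t) (word F t')) =
  q ^+ (size s' * size t) *:
    tens (word F (s ++ map (wdeg g (FMonom s')) t)) (word F (s' ++ t')).
Proof.
by rewrite !tens_word bmulE !linextU /= /wact !mmulE.
Qed.

Lemma bmul_linear s : linear (bmul g q s).
Proof.
move=> a u v; rewrite !bmulE [in RHS]/linext scaler_sumr -big_split.
apply: eq_bigr => k _ /=.
by rewrite (linearP (linext _)) scalerDr !scalerA mulrC.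
Qed.

HB.instance Definition _ s := GRing.isLinear.Build F (talg2 F A) (talg2 F A)
  *:%R (bmul g q s) (bmul_linear s).

Lemma bmul_genl x t : bmul g q (tens (gen F x) 1) t = left_letter x t.
Proof.
rewrite tens_genl; apply: (tens_lin_eq (bmul_linear _) (left_letter_lin x)) => s s'.
rewrite bmul_word mul0n expr0 scale1r left_letter_tens -word_cons /=.
rewrite (eq_map (g := id)) ?map_id // => y; exact: perm1.
Qed.

Lemma bmul_genr x t : bmul g q (tens 1 (gen F x)) t = right_letter x t.
Proof.
rewrite tens_genr; apply: (tens_lin_eq (bmul_linear _) (right_letter_lin x)) => s s'.
rewrite bmul_word mul1n right_letter_tens -word_cons twist_word tensZl.
rewrite cat0s cat1s (eq_map (g := phi g x)) // => y.
by rewrite permM perm1.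
Qed.

Lemma bmul_gen x t :
  bmul g q (tens (gen F x) 1 + tens 1 (gen F x)) t =
  left_letter x t + right_letter x t.
Proof.
apply: (etrans (bmulDl _ _ _)).
exact: (f_equal2 +%R (bmul_genl x t) (bmul_genr x t)).
Qed.

Lemma comul_word s : comul g q (word F s) =
  foldr (fun x t => bmul g q (tens (gen F x) 1 + tens 1 (gen F x)) t) (tens 1 1) s.
Proof. exact: linextU. Qed.

(** The recursion through which every property of the coproduct is proved. *)
Lemma comul_cons x s : comul g q (word F (x :: s)) =
  left_letter x (comul g q (word F s)) + right_letter x (comul g q (word F s)).
Proof. rewrite 2!comul_word; exact: bmul_gen. Qed.

Lemma comulM_gen x f : comul g q (gen F x * f) =
  left_letter x (comul g q f) + right_letter x (comul g q f).
Proof.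
apply: (word_lin_eq (h := fun f => comul g q (gen F x * f)) (h' := fun f =>
  left_letter x (comul g q f) + right_letter x (comul g q f))) => [a u v|a u v|s].
- by rewrite mulr_linr comul_lin.
- by rewrite comul_lin left_letter_lin right_letter_lin scalerDr addrACA.
by rewrite -word_cons comul_cons.
Qed.

End Coproduct.

Section TensorKernel.
Variables (F : fieldType) (A : finZmodType).
Implicit Types (I J : set (talg F A)).

Lemma tens_space_subspace I J : is_subspace (tens_space I J).
Proof. exact: lin_span_subspace. Qed.

Lemma tens_space_tens I J f h : I f -> J h -> tens_space I J (tens f h).
Proof. by move=> If Jh; apply: sub_lin_span; exists f => //; exists h. Qed.

Lemma tens_ker_subspace I : is_subspace (tens_ker I).
Proof. by apply: add_set_subspace; apply: tens_space_subspace. Qed.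

Lemma tens_kerl I f h : I f -> tens_ker I (tens f h).
Proof.
move=> If; apply: sub_add_setl; first exact: tens_space_subspace.
exact: tens_space_tens.
Qed.

Lemma tens_kerr I f h : I h -> tens_ker I (tens f h).
Proof.
move=> If; apply: sub_add_setr; first exact: tens_space_subspace.
exact: tens_space_tens.
Qed.

Lemma tens_ker_min I (S : set (talg2 F A)) : is_subspace S ->
  (forall f h, I f -> S (tens f h)) -> (forall f h, I h -> S (tens f h)) ->
  tens_ker I `<=` S.
Proof.
move=> SS Sl Sr; apply: add_set_min => //; apply: lin_span_min => //.
  by move=> _ [f If [h _ <-]]; apply: Sl.
by move=> _ [f _ [h Ih <-]]; apply: Sr.
Qed.

Lemma tens_kerS I J : I `<=` J -> tens_ker I `<=` tens_ker J.
Proof.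
move=> IJ; apply: tens_ker_min; first exact: tens_ker_subspace.
  by move=> f h /IJ; apply: tens_kerl.
by move=> f h /IJ; apply: tens_kerr.
Qed.

End TensorKernel.

(** * Reduced expressions of permutations *)

Section Matsumoto.
Variable n : nat.
Implicit Types (x y : 'S_n.+1) (i j : 'I_n) (s t : seq 'I_n).

Local Notation lo i := (widen_ord (leqnSn n) i).
Local Notation hi i := (lift ord0 i).

Definition inversions x : {set 'I_n.+1 * 'I_n.+1} :=
  [set p : 'I_n.+1 * 'I_n.+1 | (p.1 < p.2)%N && (x p.2 < x p.1)%N].

Definition inv_number x := #|inversions x|.

Lemma adjK i : (adj i * adj i = 1)%g.
Proof. exact: tperm2. Qed.

Lemma adj_lo i : adj i (lo i) = hi i. Proof. exact: tpermL. Qed.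
Lemma adj_hi i : adj i (hi i) = lo i. Proof. exact: tpermR. Qed.

Lemma adj_out i (p : 'I_n.+1) : (p != i :> nat) -> (p != i.+1 :> nat) -> adj i p = p.
Proof.
move=> pi pi1; apply: tpermD; apply/eqP => /(congr1 val) /=; last first.
  by rewrite /bump /=; move/eqP: pi1; lia.
by move/eqP: pi; lia.
Qed.

Variant adj_spec i (p : 'I_n.+1) : 'I_n.+1 -> Prop :=
| AdjLo of p = lo i : adj_spec i p (hi i)
| AdjHi of p = hi i : adj_spec i p (lo i)
| AdjOut of p != i :> nat & p != i.+1 :> nat : adj_spec i p p.

Lemma adjP i p : adj_spec i p (adj i p).
Proof.
have [pi|pi] := eqVneq (p : nat) (i : nat).
  have -> : p = lo i by apply/val_inj.
  by rewrite adj_lo; constructor.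
have [pi1|pi1] := eqVneq (p : nat) i.+1.
  have -> : p = hi i by apply/val_inj.
  by rewrite adj_hi; constructor.
by rewrite adj_out //; constructor.
Qed.

(** The transposition of [i] and [i + 1] preserves the order of all pairs of
    places except [(i, i + 1)], so it maps the inversions of [x] bijectively to
    the remaining ones. *)
Lemma inv_number_adj x i :
  (x (lo i) < x (hi i))%N -> inv_number (adj i * x)%g = (inv_number x).+1.
Proof.
move=> asc; pose f (p : 'I_n.+1 * 'I_n.+1) := (adj i p.1, adj i p.2).
have fK : involutive f by case=> a b; rewrite /f /= -!permM adjK !perm1.
rewrite /inv_number.
have -> : inversions (adj i * x)%g = ((lo i, hi i) |: (f @: inversions x))%SET.
  apply/setP => -[a b]; rewrite in_setU1 -{3}[(a, b)]fK mem_imset; last exact: inv_inj.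
  rewrite !inE /= !permM xpair_eqE.
  case: (adjP i a) => [->|->|ai ai1]; case: (adjP i b) => [->|->|bi bi1];
    rewrite -?val_eqE /= /bump /= ?eqxx ?leq0n ?add1n ?ltnn ?ltnS ?andbF ?andbT //=;
    move: asc; rewrite /= ?ltnNge; lia.
rewrite cardsU1 card_imset ?add1n; last exact: inv_inj.
rewrite (_ : _ \notin _) //; rewrite -[(_, _)]fK mem_imset; last exact: inv_inj.
by rewrite inE /= adj_lo adj_hi; apply/negP => /andP[]; rewrite /= /bump; lia.
Qed.

Lemma inv_number_adj_desc x i :
  (x (hi i) < x (lo i))%N -> inv_number x = (inv_number (adj i * x)%g).+1.
Proof.
move=> desc; rewrite -(@inv_number_adj _ i) ?mulgA ?adjK ?mul1g //.
by rewrite !permM adj_lo adj_hi.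
Qed.

Lemma adj_asc_desc x i :
  (x (lo i) < x (hi i))%N \/ (x (hi i) < x (lo i))%N.
Proof.
have [|| /val_inj/perm_inj /(congr1 val)] := ltngtP (x (lo i)) (x (hi i)); auto.
by rewrite /= /bump; lia.
Qed.

Lemma inv_number1 : inv_number 1%g = 0%N.
Proof.
apply: eq_card0 => -[a b]; rewrite !inE /= !perm1; apply/negP => /andP[]; lia.
Qed.

Lemma inv_numberV x : inv_number x^-1%g = inv_number x.
Proof.
pose f (p : 'I_n.+1 * 'I_n.+1) := (x^-1%g p.2, x^-1%g p.1).
have f_inj : injective f by move=> [a b] [c d] [/perm_inj -> /perm_inj ->].
rewrite /inv_number -(card_imset _ f_inj); apply: eq_card => -[a b].
have -> : (a, b) = f (x b, x a) by rewrite /f /= !permK.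
by rewrite mem_imset // !inE /= !permK andbC.
Qed.

Lemma increasing_perm_le x : inv_number x = 0%N -> forall p : 'I_n.+1, (p <= x p)%N.
Proof.
move=> /card0_eq x0; have xlt (a b : 'I_n.+1) : (a < b)%N -> (x a < x b)%N.
  move=> ab; have := x0 (a, b); rewrite !inE /= ab /= ltnNge => /negbFE.
  by rewrite leq_eqVlt => /orP[/eqP/val_inj/perm_inj ba|//]; rewrite ba ltnn in ab.
case=> p; elim: p => [//|p IH] pn; have pn' := ltnW pn.
by apply: leq_ltn_trans (IH pn') _; apply: xlt.
Qed.

Lemma inv_number0 x : inv_number x = 0%N -> x = 1%g.
Proof.
move=> x0; apply/permP => p; rewrite perm1; apply/val_inj/eqP; rewrite eqn_leq.
rewrite increasing_perm_le // andbT.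
by rewrite -{2}[p](permK x) increasing_perm_le // inv_numberV.
Qed.

(** Without descents [x] would be increasing, by induction on the distance of
    two places. *)
Lemma exists_descent x : (0 < inv_number x)%N -> exists i, (x (hi i) < x (lo i))%N.
Proof.
apply: contraPP => noD; apply/negP; rewrite -leqNgt leqn0; apply/eqP.
have asc i : (x (lo i) < x (hi i))%N.
  by have [//|d] := adj_asc_desc x i; case: noD; exists i.
have mono k : forall a b : 'I_n.+1, (a + k = b :> nat)%N -> (x a <= x b)%N.
  elim: k => [a b ab|k IH a b ab].
    by rewrite (_ : a = b) //; apply/val_inj; rewrite /= -ab addn0.
  have bn : (a + k < n)%N by have := ltn_ord b; lia.
  have -> : b = hi (Ordinal bn) by apply/val_inj; rewrite /= /bump /=; lia.
  by apply: leq_trans (ltnW (asc _)); apply: IH.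
apply: eq_card0 => -[a b]; rewrite !inE /=; apply/negP => /andP[ab].
by rewrite ltnNge (mono (b - a)%N) // subnKC // ltnW.
Qed.

Lemma expr_val_cons i s : expr_val (i :: s) = (adj i * expr_val s)%g.
Proof. by rewrite /expr_val big_cons. Qed.

Lemma expr_val_rcons i s : expr_val (rcons s i) = (expr_val s * adj i)%g.
Proof. by rewrite /expr_val -cats1 big_cat big_seq1. Qed.

Lemma inv_number_le s : (inv_number (expr_val s) <= size s)%N.
Proof.
elim: s => [|i s IH]; first by rewrite /expr_val big_nil inv_number1.
rewrite expr_val_cons /=.
have [/inv_number_adj ->//|/inv_number_adj_desc e] := adj_asc_desc (expr_val s) i.
by rewrite e in IH; lia.
Qed.

Definition reduced s := size s == inv_number (expr_val s).

Lemma reduced_ex x : exists2 s, expr_val s = x & reduced s.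
Proof.
have [k] := ubnP (inv_number x); elim: k x => // k IH x xk.
have [x0|/exists_descent[i /inv_number_adj_desc xi]] := posnP (inv_number x).
  by exists [::]; rewrite /reduced /expr_val big_nil ?inv_number1 // (inv_number0 x0).
have [|s sx rs] := IH (adj i * x)%g; first by rewrite xi in xk.
have sx' : expr_val (i :: s) = x by rewrite expr_val_cons sx mulgA adjK mul1g.
exists (i :: s); rewrite // /reduced sx' /= xi eqSS -sx.
exact: rs.
Qed.

(** The length of the shortest expressions is the number of inversions: removing
    descents one by one produces an expression of that size, and no expression is
    shorter since one letter changes the number by one. *)
Lemma shortestP x : expr_val (shortest x) = x /\ reduced (shortest x).
Proof.
rewrite /shortest; case: cid => s /= [sx min]; split=> //.
rewrite /reduced sx eqn_leq -{2}sx inv_number_le andbT.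
by have [t tx] := reduced_ex x; rewrite /reduced tx => /eqP <-; apply: min.
Qed.

Lemma reduced_cons i s : reduced (i :: s) ->
  reduced s /\ (expr_val (i :: s) (hi i) < expr_val (i :: s) (lo i))%N.
Proof.
rewrite /reduced expr_val_cons /= !permM adj_lo adj_hi.
have [a|/inv_number_adj_desc e] := adj_asc_desc (expr_val s) i.
  by rewrite inv_number_adj // eqSS.
by have := inv_number_le s; rewrite e => /leP; move=> ? /eqP; lia.
Qed.

Lemma reduced_cons_desc x i s :
  reduced s -> expr_val s = (adj i * x)%g -> (x (hi i) < x (lo i))%N ->
  reduced (i :: s) /\ expr_val (i :: s) = x.
Proof.
move=> rs sx /inv_number_adj_desc e.
have sx' : expr_val (i :: s) = x by rewrite expr_val_cons sx mulgA adjK mul1g.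
by split=> //; rewrite /reduced sx' e /= eqSS -sx.
Qed.

Lemma expr_val_tail x i s : expr_val (i :: s) = x -> expr_val s = (adj i * x)%g.
Proof. by rewrite expr_val_cons => <-; rewrite mulgA adjK mul1g. Qed.

Lemma adj_comm i j : (i.+1 < j)%N -> (adj i * adj j = adj j * adj i)%g.
Proof.
move=> ij; apply/permP => p; rewrite !permM.
case: (adjP i p) => [->|->|pi pi1].
- by rewrite !(@adj_out j) ?adj_lo //= /bump; lia.
- by rewrite !(@adj_out j) ?adj_hi //= /bump; lia.
by case: (adjP j p) => [_|_|_ _]; rewrite adj_out //= /bump; lia.
Qed.

Section Operators.
Variables (X : Type) (P : X -> Prop) (tau : 'I_n -> X -> X).
Hypothesis tauP : forall i w, P w -> P (tau i w).
Hypothesis tau_comm : forall i j w,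
  (i.+1 < j)%N -> P w -> tau i (tau j w) = tau j (tau i w).
Hypothesis tau_braid : forall i j w,
  j = i.+1 :> nat -> P w -> tau i (tau j (tau i w)) = tau j (tau i (tau j w)).

Definition run s w := foldr tau w s.

Lemma runP s w : P w -> P (run s w).
Proof. by move=> Pw; elim: s => //= i s; apply: tauP. Qed.

(** Induction on the length.  If the first letters [i] and [j] of [s] and [t]
    differ, both are descents of the common value, which therefore also has
    reduced expressions that start with [i j] and with [j i], respectively with
    [i j i] and with [j i j], and continue in the same way.  The induction
    hypothesis connects [s] and [t] to these, and the relations between the
    operators connect these to each other.  The predicate [P] restricts the
    relations to the words that are long enough for the operators to act. *)
Lemma matsumoto s t w :
  reduced s -> reduced t -> expr_val s = expr_val t -> P w -> run s w = run t w.
Proof.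
move=> rs rt st Pw; have [k] := ubnP (size s); elim: k => // k IH in s t rs rt st *.
have ss : size s = size t by rewrite (eqP rs) (eqP rt) st.
case: s t => [|i s] [|j t] // in rs rt st ss *; rewrite /= ltnS => sk.
case: ss => ss; pose x := expr_val (i :: s).
have [rs' di] := reduced_cons rs; have [rt' dj] := reduced_cons rt.
rewrite -st -/x in dj; rewrite -/x in di.
have sx : expr_val s = (adj i * x)%g by apply: expr_val_tail.
have tx : expr_val t = (adj j * x)%g by apply: expr_val_tail; rewrite -st.
have [ij|ij] := eqVneq (i : nat) j.
  by move/val_inj: ij sx => -> sx; rewrite (IH s t) // sx tx.
wlog {ij} ij : i j s t rs rt st ss sk @x rs' di rt' dj sx tx / (i < j)%N.
  move=> W; have [ij'|ij'|/eqP//] := ltngtP (i : nat) j; last by rewrite (negPf ij).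
    exact: W.
  apply/esym; apply: (W j i t s) => //; rewrite -?ss //; rewrite -/x -?st //.
have [{}ij|ij'] := leqP i.+2 j.
  have [u ux ru] := reduced_ex (adj j * (adj i * x))%g.
  have [|||rju ju] := @reduced_cons_desc (adj i * x)%g j u => //.
    by rewrite !permM !adj_out //= /bump; lia.
  have [|||riu iu] := @reduced_cons_desc (adj j * x)%g i u => //.
    by rewrite ux !mulgA (adj_comm ij).
    by rewrite !permM !adj_out //= /bump; lia.
  rewrite (IH s (j :: u)) ?ju // (IH t (i :: u)) ?iu -?ss //.
  by rewrite /= tau_comm //; apply: runP.
have ji : j = i.+1 :> nat by lia.
have lohi : lo j = hi i by apply/val_inj; rewrite /= /bump ji.
have xi p : (adj i * x)%g p = x (adj i p) by rewrite permM.
have xj p : (adj j * x)%g p = x (adj j p) by rewrite permM.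
have hij : adj i (hi j) = hi j by rewrite adj_out //= /bump; lia.
have loj : adj j (lo i) = lo i by rewrite adj_out //= /bump; lia.
have braid : (adj i * (adj j * (adj i * x)) = adj j * (adj i * (adj j * x)))%g.
  rewrite !mulgA; congr (_ * _)%g; apply/permP => p; rewrite !permM.
  case: (adjP i p) => [->|->|pi pi1].
  - by rewrite loj adj_lo -lohi adj_lo hij.
  - by rewrite loj adj_lo -lohi adj_lo hij adj_hi.
  case: (adjP j p) => [pj|_|pj pj1].
  - by move: pi1; rewrite pj /= ji eqxx.
  - by rewrite lohi adj_hi loj.
  - by rewrite adj_out ?adj_out.
rewrite lohi in dj.
have [u ux ru] := reduced_ex (adj i * (adj j * (adj i * x)))%g.
have [||| riu iu] := @reduced_cons_desc (adj j * (adj i * x))%g i u => //.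
  by rewrite !permM loj adj_lo -{1}lohi adj_lo hij.
have [||| rjiu jiu] := @reduced_cons_desc (adj i * x)%g j (i :: u) => //.
  by rewrite !xi hij lohi adj_hi; apply: ltn_trans dj di.
have [||| rju ju] := @reduced_cons_desc (adj i * (adj j * x))%g j u => //.
  by rewrite ux braid.
  by rewrite !permM hij adj_hi lohi adj_hi loj.
have [||| riju iju] := @reduced_cons_desc (adj j * x)%g i (j :: u) => //.
  by rewrite !xj loj -lohi adj_lo; apply: ltn_trans dj di.
rewrite (IH s (j :: i :: u)) ?jiu // (IH t (i :: j :: u)) ?iju -?ss //.
by rewrite /= tau_braid //; apply: runP.
Qed.

End Operators.
End Matsumoto.

(** * The braid relations *)

Section Homogeneous.
Variables (F : fieldType) (A : finZmodType).
Implicit Types (f : talg F A) (s : seq A).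

Lemma ncomp_word N s : ncomp N (word F s) = if size s == N then word F s else 0.
Proof. exact: wcomp_word. Qed.

Lemma ncomp_lin N a f h :
  ncomp N (a *: f + h) = a *: ncomp N f + ncomp N h :> talg F A.
Proof. exact: (linearP (wcomp (fun w : {fmonom A} => size w == N))). Qed.

Lemma ncomp0 N : ncomp N 0 = 0 :> talg F A.
Proof. exact: (linear0 (wcomp (fun w : {fmonom A} => size w == N))). Qed.

Lemma homogP N f : homog_deg N f <-> ncomp N f = f.
Proof.
split=> [hf|hf w]; first by apply: wcomp_id => w /hf /eqP.
by rewrite -mcoeff_neq0 -hf wcomp_coef; case: (size w =P N); rewrite ?eqxx.
Qed.

Lemma homog_subspace N : is_subspace (@homog_deg F A N).
Proof.
split=> [|a u v /homogP hu /homogP hv]; apply/homogP; first exact: ncomp0.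
by rewrite ncomp_lin hu hv.
Qed.

Lemma homog_word s : homog_deg (size s) (word F s).
Proof. by apply/homogP; rewrite ncomp_word eqxx. Qed.

Lemma homog_ind N (S : set (talg F A)) f : is_subspace S ->
  (forall s, size s = N -> S (word F s)) -> homog_deg N f -> S f.
Proof.
move=> SS Sw /homogP <-; apply: (word_ind (S := [set f | S (ncomp N f)])).
  split=> [|a u v /= Su Sv]; first by rewrite /= ncomp0; apply: subspace0.
  by rewrite ncomp_lin; apply: SS.2.
by move=> s /=; rewrite ncomp_word; case: eqP => [/Sw|_] //; apply: subspace0.
Qed.

(** Relations between the [sigma i] hold only on words of sufficient length,
    hence this restriction to one degree. *)
Lemma homog_lin_eq N (E : lmodType F) (h h' : talg F A -> E) f :
  linear h -> linear h' ->
  (forall s, size s = N -> h (word F s) = h' (word F s)) ->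
  homog_deg N f -> h f = h' f.
Proof.
move=> lh lh' hh'.
exact: (homog_ind (S := [set f | h f = h' f]) (eq_subspace lh lh')).
Qed.

Lemma homog_ncomp_neq N M f : homog_deg N f -> M != N -> ncomp M f = 0.
Proof.
by move=> hf MN; apply: wcomp_eq0 => w /hf wN /=; rewrite wN eq_sym.
Qed.

End Homogeneous.

Section BraidLifts.
Variables (F : fieldType) (A : finZmodType) (g : {perm A}) (q : F).
Hypothesis gD : {morph g : x y / x + y}.
Implicit Types (f : talg F A) (s u v : seq A).

(** Self-distributivity of the rack: the reason for the braid relation below. *)
Lemma affop_distr x y z :
  affop g x (affop g y z) = affop g (affop g x y) (affop g x z).
Proof.
have gN := additive_funN gD.
rewrite /affop [in RHS]opprD [in RHS](addrACA x) subrr add0r.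
rewrite -gN opprB -gD addrA subrK -[RHS]addrA -gD.
by rewrite addrAC.
Qed.

HB.instance Definition _ i := GRing.Linear.on (@sigma F A g q i).

Lemma sigma_lin i a f h :
  sigma g q i (a *: f + h) = a *: sigma g q i f + sigma g q i h.
Proof. exact: linearP. Qed.

Lemma sigmaZ i a f : sigma g q i (a *: f) = a *: sigma g q i f.
Proof. exact: linearZ. Qed.

Lemma sigma_word i u x y v : size u = i ->
  sigma g q i (word F (u ++ x :: y :: v)) =
  q *: word F (u ++ affop g x y :: x :: v).
Proof.
move=> <-; apply: etrans (linextU _ _) _.
rewrite (drop_size_cat (x :: y :: v) (erefl (size u))).
rewrite (take_size_cat (x :: y :: v) (erefl (size u))).
reflexivity.
Qed.

Lemma split_two i s : (i.+1 < size s)%N ->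
  exists u x y v, size u = i /\ s = u ++ x :: y :: v.
Proof.
move=> i1s; have i0s := ltnW i1s; case: s i1s i0s => // x0 s i1s i0s.
exists (take i (x0 :: s)), (nth x0 (x0 :: s) i), (nth x0 (x0 :: s) i.+1).
exists (drop i.+2 (x0 :: s)); split; first by rewrite size_takel // ltnW.
by rewrite -!drop_nth // cat_take_drop.
Qed.

Lemma sigma_homog N i f :
  (i.+1 < N)%N -> homog_deg N f -> homog_deg N (sigma g q i f).
Proof.
move=> iN; apply: (homog_ind (S := [set f | homog_deg N (sigma g q i f)])).
  split=> [|a u v /= hu hv]; first by rewrite /= linear0; apply: subspace0; apply: homog_subspace.
  by rewrite sigma_lin; apply: (homog_subspace F A N).2.
move=> s sN /=; have [|u [x [y [v [ui sE]]]]] := @split_two i s; first by rewrite sN.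
rewrite sE sigma_word //; apply: (subspaceZ q (homog_subspace F A N)).
by rewrite -sN sE size_cat -(size_cat u (affop g x y :: x :: v)); apply: homog_word.
Qed.

Lemma sigma2_linear i j : linear (fun f => sigma g q i (sigma g q j f)).
Proof. by move=> a u v; rewrite !sigma_lin. Qed.

Lemma sigma3_linear i j k :
  linear (fun f => sigma g q i (sigma g q j (sigma g q k f))).
Proof. by move=> a u v; rewrite !sigma_lin. Qed.

Lemma sigma_comm N i j f : (i.+1 < j)%N -> (j.+1 < N)%N -> homog_deg N f ->
  sigma g q i (sigma g q j f) = sigma g q j (sigma g q i f).
Proof.
move=> ij jN; apply: (homog_lin_eq (sigma2_linear i j) (sigma2_linear j i)).
move=> s sN; have [|u [x [y [v [ui sE]]]]] := @split_two i s; first by lia.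
have [|u' [x' [y' [v' [ui' vE]]]]] := @split_two (j - i.+2) v.
  by move: sN; rewrite sE size_cat /=; lia.
rewrite sE vE.
have cE a b w : u ++ a :: b :: u' ++ w = (u ++ a :: b :: u') ++ w by rewrite -catA.
have sz a b : size (u ++ a :: b :: u') = j by rewrite size_cat /= ui' ui; lia.
rewrite (sigma_word _ _ _ ui) cE (sigma_word _ _ _ (sz _ _)) !sigmaZ.
by rewrite -cE (sigma_word _ _ _ ui) [in RHS]cE (sigma_word _ _ _ (sz _ _)) -cE.
Qed.

Lemma sigma_braid N i f : (i.+2 < N)%N -> homog_deg N f ->
  sigma g q i (sigma g q i.+1 (sigma g q i f)) =
  sigma g q i.+1 (sigma g q i (sigma g q i.+1 f)).
Proof.
move=> iN; apply: (homog_lin_eq (sigma3_linear i i.+1 i) (sigma3_linear i.+1 i i.+1)).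
move=> s sN; have [|u [x [y [[|z v] [ui sE]]]]] := @split_two i s; first by lia.
  by move: sN; rewrite sE size_cat /=; lia.
have S0 a b w : sigma g q i (word F (u ++ a :: b :: w)) =
    q *: word F (u ++ affop g a b :: a :: w) by apply: sigma_word.
have S1 a b c w : sigma g q i.+1 (word F (u ++ a :: b :: c :: w)) =
    q *: word F (u ++ a :: affop g b c :: b :: w).
  have := @sigma_word i.+1 (u ++ [:: a]) b c w.
  by rewrite -!catA size_cat addn1 ui; apply.
rewrite sE S0 S1 !sigmaZ S1 S0 !sigmaZ S0 S1.
by rewrite -affop_distr.
Qed.

End BraidLifts.

(** * Summing braid lifts over the symmetric group *)

Section QuantumSymmetrizer.
Variables (F : fieldType) (A : finZmodType) (g : {perm A}) (q : F) (n : nat).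
Hypothesis gD : {morph g : x y / x + y}.
Implicit Types (f : talg F A) (x : 'S_n.+1) (i : 'I_n) (s : seq 'I_n).

Local Notation lo i := (widen_ord (leqnSn n) i).
Local Notation hi i := (lift ord0 i).
Local Notation runs := (run (fun i : 'I_n => @sigma F A g q i)).

Lemma braid_liftE x f : braid_lift g q x f = runs (shortest x) f.
Proof.
by rewrite /braid_lift; elim: (shortest x) => [//|i s IH]; exact: (f_equal (sigma g q i) IH).
Qed.

Lemma runs_linear s : linear (runs s).
Proof. by move=> a u v; elim: s => //= i s ->; rewrite sigma_lin. Qed.

Lemma braid_lift_linear x : linear (braid_lift g q x).
Proof. by move=> a u v; rewrite !braid_liftE runs_linear. Qed.

Lemma runs_homog s f : homog_deg n.+1 f -> homog_deg n.+1 (runs s f).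
Proof.
by move=> hf; elim: s => //= i s; apply: sigma_homog; rewrite ltnS.
Qed.

Lemma runs_reduced s t f : reduced s -> reduced t -> expr_val s = expr_val t ->
  homog_deg n.+1 f -> runs s f = runs t f.
Proof.
apply: matsumoto => [i w|i j w ij|i j w ij].
- by apply: sigma_homog; rewrite ltnS.
- by apply: sigma_comm; rewrite ?ltnS.
by rewrite ij; apply: sigma_braid; rewrite // ltnS -ij.
Qed.

(** If the letters that [x] takes from places [i] and [i + 1] do not cross, then
    appending [i] to a shortest expression of [x] gives a reduced expression. *)
Lemma braid_lift_adj x i f : (x^-1%g (lo i) < x^-1%g (hi i))%N ->
  homog_deg n.+1 f -> braid_lift g q (x * adj i)%g f = braid_lift g q x (sigma g q i f).
Proof.
move=> asc hf; have [sx rx] := shortestP x; have [sy ry] := shortestP (x * adj i)%g.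
have vy : expr_val (rcons (shortest x) i) = (x * adj i)%g by rewrite expr_val_rcons sx.
have rs : reduced (rcons (shortest x) i).
  rewrite /reduced vy size_rcons (eqP rx) sx -[inv_number (x * _)]inv_numberV invMg.
  by rewrite /adj tpermV -/(adj i) inv_number_adj // inv_numberV.
rewrite !braid_liftE (runs_reduced ry rs) ?vy //.
by rewrite /run foldr_rcons.
Qed.

(** The elements of [Y] come in pairs [x], [x * adj i] with one ascent at [i] in
    each pair; the lifts of a pair add up to the lift of [x] applied to
    [f + sigma g q i f]. *)
Lemma sum_braid_lift_pair (Y : {set 'S_n.+1}) i f :
  (forall x, x \in Y -> (x * adj i)%g \in Y) -> homog_deg n.+1 f ->
  f + sigma g q i f = 0 -> \sum_(x in Y) braid_lift g q x f = 0.
Proof.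
move=> Yi hf ff; pose asc x := (x^-1%g (lo i) < x^-1%g (hi i))%N.
have mulK x : (x * adj i * adj i)%g = x by rewrite -mulgA adjK mulg1.
have YiE x : ((x * adj i)%g \in Y) = (x \in Y).
  by apply/idP/idP => [/Yi|/Yi//]; rewrite mulK.
have ascN x : asc (x * adj i)%g = ~~ asc x.
  rewrite /asc invMg /adj tpermV -/(adj i) !permM adj_lo adj_hi.
  have [a|d] := adj_asc_desc x^-1%g i; first by rewrite a ltnNge ltnW.
  by rewrite d ltnNge ltnW.
rewrite (bigID asc) /= [X in _ + X](reindex_inj (mulIg (adj i))) /=.
under [X in _ + X]eq_bigl => x do rewrite YiE ascN negbK.
rewrite -big_split big1 // => x /andP[_ ax].
have := braid_lift_linear x 1 f (sigma g q i f).
rewrite !scale1r ff (linear_fun0 (braid_lift_linear x)) => e.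
by rewrite braid_lift_adj.
Qed.

(** The letters are applied from the right: first [k], last [n - 1], so that the
    operator carries the letter in place [k] over all letters after it. *)
Definition to_last (k : nat) : seq 'I_n := rev (drop k (enum 'I_n)).

Lemma to_last_rcons (k : 'I_n) : to_last k = rcons (to_last k.+1) k.
Proof.
rewrite /to_last (drop_nth k) ?size_enum_ord ?ltn_ord // rev_cons.
by rewrite nth_ord_enum.
Qed.

Lemma to_last_max (k : nat) : (n <= k)%N -> to_last k = [::].
Proof. by move=> nk; rewrite /to_last drop_oversize // size_enum_ord. Qed.

(** Descending induction on [k]: as [x] fixes the last place, each letter that is
    appended creates an inversion, so lengths add up. *)
Lemma to_last_lift (d : nat) (k : 'I_n.+1) x f : (k + d = n)%N ->
  homog_deg n.+1 f -> x ord_max = ord_max ->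
  expr_val (to_last k) ord_max = k /\
  braid_lift g q (x * expr_val (to_last k))%g f =
    braid_lift g q x (runs (to_last k) f).
Proof.
elim: d k f => [|d IH] k f kd hf xm.
  have nk : (n <= k)%N by move: kd; lia.
  rewrite (to_last_max nk) /expr_val big_nil perm1 mulg1; split=> //.
  by apply/val_inj => /=; move: kd; lia.
have kn : (k < n)%N by move: kd; lia.
pose i := Ordinal kn; have -> : to_last k = rcons (to_last k.+1) i.
  exact: (to_last_rcons i).
have [||e1 e2] := IH (hi i) (sigma g q i f) _ _ xm.
- by move: kd; rewrite /= /bump; lia.
- by apply: sigma_homog; rewrite ?ltnS.
have hik : hi i = k.+1 :> nat by [].
rewrite hik in e1 e2.
rewrite expr_val_rcons permM e1 adj_hi; split; first exact: val_inj.
rewrite mulgA braid_lift_adj //; first by rewrite e2 /run foldr_rcons.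
set y := (x * _)%g; have ym : y ord_max = hi i by rewrite /y permM xm e1.
rewrite -ym permK; set p := (y^-1)%g _.
have : p != ord_max.
  apply/eqP => /(congr1 y); rewrite permKV ym => /(congr1 val) /=.
  by rewrite /bump /=; lia.
by rewrite -val_eqE /= ltn_neqAle leq_ord => ->.
Qed.

(** The coset decomposition of the symmetric group with respect to the
    stabilizer of the last place. *)
Lemma sum_braid_lift f : homog_deg n.+1 f ->
  \sum_(x : 'S_n.+1) braid_lift g q x f =
  \sum_(x : 'S_n.+1 | x ord_max == ord_max)
    braid_lift g q x (\sum_(k < n.+1) runs (to_last k) f).
Proof.
move=> hf; have kn (k : 'I_n.+1) : (k + (n - k) = n)%N by rewrite subnKC // leq_ord.
rewrite (partition_big (fun x : 'S_n.+1 => x ord_max) predT) //=.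
under [RHS]eq_bigr => x _ do rewrite (linear_sum_fun _ _ _ (braid_lift_linear x)).
rewrite exchange_big; apply: eq_bigr => k _.
rewrite (reindex_inj (mulIg (expr_val (to_last k)))) /=.
have id_max : (1%g : 'S_n.+1) ord_max = ord_max by rewrite perm1.
have [tk _] := to_last_lift (kn k) hf id_max.
have tE x : ((x * expr_val (to_last k))%g ord_max == k) = (x ord_max == ord_max).
  rewrite permM; apply/eqP/eqP => [h|->]; last exact: tk.
  by apply: (@perm_inj _ (expr_val (to_last k))); rewrite h tk.
apply: eq_big => [//|x]; rewrite tE => /eqP xm.
exact: (to_last_lift (kn k) hf xm).2.
Qed.

End QuantumSymmetrizer.

(** * Components of the coproduct *)

Section Derivation.
Variables (F : fieldType) (A : finZmodType) (g : {perm A}) (q : F).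
Implicit Types (f h : talg F A) (s u v : seq A).

Lemma counit_lin a f h : counit (a *: f + h) = a * counit f + counit h.
Proof. by rewrite /counit mcoeffD mcoeffZ. Qed.

Lemma counitZ a f : counit (a *: f) = a * counit f.
Proof. by rewrite /counit mcoeffZ. Qed.

Lemma counit_word s : counit (word F s) = (s == [::])%:R.
Proof. by rewrite /counit [mone]fmoneE word_coef. Qed.

Lemma counit_genM x f : counit (gen F x * f) = 0.
Proof.
apply: (word_lin_eq (E := F^o) (h := fun f => counit (gen F x * f))
  (h' := fun=> 0)) => [a u v|a u v|s].
- by rewrite mulr_linr counit_lin.
- by rewrite scaler0 addr0.
by rewrite -word_cons counit_word.
Qed.

Lemma counitM_gen x f : counit (f * gen F x) = 0.
Proof.
apply: (word_lin_eq (E := F^o) (h := fun f => counit (f * gen F x))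
  (h' := fun=> 0)) => [a u v|a u v|s].
- by rewrite mulr_linl counit_lin.
- by rewrite scaler0 addr0.
by rewrite wordM counit_word; case: s.
Qed.

Definition right_coef (w : {fmonom A}) : talg2 F A -> talg F A :=
  linext (fun k : {fmonom A} * {fmonom A} =>
    (<< k.2 >> : talg F A)@_w *: << k.1 >>).

(** The identity on [T(V)] tensored with the counit. *)
Definition left_part := right_coef mone.

(** Multiplies out the components of a tensor that have degree one on the
    right, and kills all others. *)
Definition last_part : talg2 F A -> talg F A :=
  linext (fun k : {fmonom A} * {fmonom A} => << k.1 >> * ncomp 1 << k.2 >>).

HB.instance Definition _ w := GRing.Linear.on (right_coef w).
HB.instance Definition _ := GRing.Linear.on left_part.
HB.instance Definition _ := GRing.Linear.on last_part.

Lemma last_part_lin (a : F) (u v : talg2 F A) :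
  last_part (a *: u + v) = a *: last_part u + last_part v.
Proof. exact: linearP. Qed.

Lemma left_part_lin (a : F) (u v : talg2 F A) :
  left_part (a *: u + v) = a *: left_part u + left_part v.
Proof. exact: linearP. Qed.

Lemma right_coef_lin w (a : F) (u v : talg2 F A) :
  right_coef w (a *: u + v) = a *: right_coef w u + right_coef w v.
Proof. exact: linearP. Qed.

Lemma right_coef_tens w f h : right_coef w (tens f h) = h@_w *: f.
Proof.
apply: (tens_lin2_eq (b := fun f h => h@_w *: f)) => [a u v|u a v v'|u a v v'|s t].
- exact: right_coef_lin.
- by rewrite mcoeffD mcoeffZ scalerDl scalerA.
- by rewrite scalerDr !scalerA mulrC.
- by rewrite tens_word; apply: linextU.
Qed.

Lemma left_part_tens f h : left_part (tens f h) = counit h *: f.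
Proof. exact: right_coef_tens. Qed.

Lemma last_part_tens f h : last_part (tens f h) = f * ncomp 1 h.
Proof.
apply: (tens_lin2_eq (b := fun f h => f * ncomp 1 h)) => [a u v|u a v w|u a v w|s t].
- exact: last_part_lin.
- by rewrite ncomp_lin mulr_linr.
- by rewrite mulr_linl.
- by rewrite tens_word; apply: linextU.
Qed.

Lemma left_part_left x (t : talg2 F A) :
  left_part (left_letter x t) = gen F x * left_part t.
Proof.
apply: (tens_lin_eq (h := fun t => left_part (left_letter x t))
  (h' := fun t => gen F x * left_part t)) => [a u v|a u v|s s'].
- by rewrite left_letter_lin left_part_lin.
- by rewrite left_part_lin mulr_linr.
by rewrite left_letter_tens [LHS]left_part_tens left_part_tens mulr_scaler.
Qed.

Lemma left_part_right x (t : talg2 F A) : left_part (right_letter g q x t) = 0.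
Proof.
apply: (tens_lin_eq (h := fun t => left_part (right_letter g q x t))
  (h' := fun=> 0)) => [a u v|a u v|s s'].
- by rewrite right_letter_lin left_part_lin.
- by rewrite scaler0 addr0.
by rewrite right_letter_tens left_part_tens counit_genM scale0r.
Qed.

Lemma left_part_comul s : left_part (comul g q (word F s)) = word F s.
Proof.
elim: s => [|x s IH].
  rewrite comul_word left_part_tens (_ : counit 1 = 1) ?scale1r; first exact: word1.
  by rewrite word1 counit_word.
rewrite comul_cons (linearD_fun _ _ left_part_lin).
apply: (etrans (f_equal2 +%R (left_part_left _ _) (left_part_right _ _))).
by rewrite addr0 IH word_cons.
Qed.

Lemma ncomp1_genM x h : ncomp 1 (gen F x * h) = counit h *: gen F x.
Proof.
apply: (word_lin_eq (h := fun h => ncomp 1 (gen F x * h))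
  (h' := fun h => counit h *: gen F x)) => [a u v|a u v|s].
- by rewrite mulr_linr ncomp_lin.
- by rewrite counit_lin scalerDl scalerA.
rewrite -word_cons ncomp_word counit_word eqSS.
by case: s => [|y s]; rewrite /= ?scale1r ?scale0r.
Qed.

Lemma last_part_left x (t : talg2 F A) :
  last_part (left_letter x t) = gen F x * last_part t.
Proof.
apply: (tens_lin_eq (h := fun t => last_part (left_letter x t))
  (h' := fun t => gen F x * last_part t)) => [a u v|a u v|s s'].
- by rewrite left_letter_lin last_part_lin.
- by rewrite last_part_lin mulr_linr.
by rewrite left_letter_tens [LHS]last_part_tens last_part_tens mulrA.
Qed.

Lemma last_part_right x (t : talg2 F A) :
  last_part (right_letter g q x t) = twist g q x (left_part t) * gen F x.
Proof.
apply: (tens_lin_eq (h := fun t => last_part (right_letter g q x t))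
  (h' := fun t => twist g q x (left_part t) * gen F x)) => [a u v|a u v|s s'].
- by rewrite right_letter_lin last_part_lin.
- by rewrite left_part_lin twist_lin mulr_linl.
rewrite right_letter_tens [LHS]last_part_tens left_part_tens ncomp1_genM mulr_scaler.
by rewrite (linearZ_fun _ _ (twist_lin g q x)) -scalerAl.
Qed.

(** The contribution to the last part of the coproduct in which the letter in
    place [k] is the right factor; it has then passed all letters after it, which
    is also the effect of [to_last]. *)
Definition pass_right s (k : nat) : talg F A :=
  let v := drop k.+1 s in let y := nth 0 s k in
  q ^+ size v *: word F (take k s ++ rcons (map (affop g y) v) y).

Lemma last_part_comul s : last_part (comul g q (word F s)) =
  \sum_(k < size s) pass_right s k.
Proof.
elim: s => [|x s IH].
  rewrite big_ord0 comul_word last_part_tens (_ : ncomp 1 1 = 0) ?mulr0 //.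
  by rewrite word1 ncomp_word.
rewrite comul_cons (linearD_fun _ _ last_part_lin).
apply: (etrans (f_equal2 +%R (last_part_left _ _) (last_part_right _ _))).
rewrite left_part_comul IH big_ord_recl addrC mulr_sumr twist_word.
have e0 : q ^+ size s *: word F (map (phi g x) s) * gen F x = pass_right (x :: s) 0.
  rewrite -scalerAl wordM cats1 /pass_right /= drop0.
  by rewrite (eq_map (g := affop g x)) // => y; rewrite permE.
apply: (f_equal2 +%R e0); apply: eq_bigr => k _.
exact: (etrans (mulr_scaler _ _ _) (f_equal _ (esym (word_cons _ _ _)))).
Qed.

End Derivation.

(** * The quantum symmetrizer and the coproduct *)

Section Primitive.
Variables (F : fieldType) (A : finZmodType) (g : {perm A}) (q : F).
Hypothesis gD : {morph g : x y / x + y}.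
Implicit Types (f h : talg F A) (s u v : seq A).

Lemma runs_to_last n (k : nat) u y v : size u = k -> (k + size v = n)%N ->
  run (fun i : 'I_n => @sigma F A g q i) (to_last n k) (word F (u ++ y :: v)) =
  q ^+ size v *: word F (u ++ rcons (map (affop g y) v) y).
Proof.
elim: v u k => [|z v IH] u k uk kn.
  by rewrite to_last_max ?scale1r //; move: kn; rewrite /=; lia.
have kn' : (k < n)%N by move: kn; rewrite /=; lia.
rewrite (to_last_rcons (Ordinal kn')) /run foldr_rcons /= sigma_word //.
rewrite -/(run _ _ _) (linearZ_fun _ _ (runs_linear _ _ _)).
have := IH (u ++ [:: affop g y z]) k.+1; rewrite -!catA /= => ->.
- by rewrite scalerA -exprS.
- by rewrite size_cat addn1 uk.
by move: kn; rewrite /=; lia.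
Qed.

Lemma sum_runs_to_last n s : size s = n.+1 ->
  \sum_(k < n.+1) run (fun i : 'I_n => @sigma F A g q i) (to_last n k) (word F s) =
  last_part (comul g q (word F s)).
Proof.
move=> sn; rewrite last_part_comul sn; apply: eq_bigr => k _.
have ks : (k < size s)%N by rewrite sn.
rewrite -{1}[s](cat_take_drop k) (drop_nth 0 ks) runs_to_last //.
  by rewrite size_takel // ltnW.
by rewrite size_drop sn; have := ltn_ord k; lia.
Qed.

Lemma sum_runs_to_last_homog n f : homog_deg n.+1 f ->
  \sum_(k < n.+1) run (fun i : 'I_n => @sigma F A g q i) (to_last n k) f =
  last_part (comul g q f).
Proof.
have l1 : linear (fun f : talg F A =>
    \sum_(k < n.+1) run (fun i : 'I_n => @sigma F A g q i) (to_last n k) f).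
  move=> a u v; rewrite scaler_sumr -big_split.
  by apply: eq_bigr => k _; rewrite runs_linear.
have l2 : linear (fun f : talg F A => last_part (comul g q f)).
  by move=> a u v; rewrite comul_lin last_part_lin.
exact: (homog_lin_eq l1 l2 (@sum_runs_to_last n)).
Qed.

(** Restriction of the quantum symmetrizer to the permutations that fix the last
    place; the projection to degree [n + 1] makes it defined on all of [T(V)]. *)
Definition last_sum (n : nat) f : talg F A :=
  \sum_(x : 'S_n.+1 | x ord_max == ord_max) braid_lift g q x (ncomp n.+1 f).

Lemma last_sum_linear n : linear (last_sum n).
Proof.
move=> a u v; rewrite scaler_sumr -big_split; apply: eq_bigr => x _.
by rewrite ncomp_lin (braid_lift_linear g q x).
Qed.

Lemma qsym_last_part n f : homog_deg n.+1 f ->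
  qsym g q n.+1 f = last_sum n (last_part (comul g q f)).
Proof.
move=> hf; rewrite /= (sum_braid_lift q gD hf) /last_sum.
have hl : homog_deg n.+1 (last_part (comul g q f)).
  rewrite -(sum_runs_to_last_homog hf); apply: (subspace_sum _ (homog_subspace F A n.+1)).
  by move=> k _; apply: runs_homog.
by rewrite ((homogP _ _).1 hl) (sum_runs_to_last_homog hf).
Qed.

Lemma braid_lift1 n f : braid_lift g q (1%g : 'S_n.+1) f = f.
Proof.
rewrite braid_liftE; have [s1 /eqP] := shortestP (1%g : 'S_n.+1).
by rewrite s1 inv_number1; case: (shortest _).
Qed.

Lemma qsym2E f : homog_deg 2 f -> qsym g q 2 f = f + sigma g q 0 f.
Proof.
move=> hf; rewrite /= (sum_braid_lift q gD hf) (big_pred1 (1%g : 'S_2)); last first.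
  move=> x; apply/eqP/eqP => [xm|->]; last by rewrite perm1.
  apply/permP => p; rewrite perm1; have [->//|pm] := eqVneq p ord_max.
  have : x p != ord_max by rewrite -[X in _ != X]xm (inj_eq perm_inj).
  move: pm (ltn_ord p) (ltn_ord (x p)); rewrite -!val_eqE /= => p1 p2 xp2 xp1.
  by apply/val_inj => /=; move: p1 p2 xp1 xp2; lia.
rewrite braid_lift1 !big_ord_recl big_ord0 addr0 addrC /=.
have -> : to_last 1 (bump 0 0) = [::] by apply: to_last_max.
have -> // : to_last 1 0 = [:: ord0].
by rewrite (to_last_rcons (@ord0 0)) to_last_max.
Qed.

(** The factor [y] on the right keeps the two places of [k] away from the last
    place, so the stabilizer of the last place is closed under the transposition
    of these two places and the summands cancel in pairs. *)
Lemma last_sum_ideal n h h' y k : kerQ2 g q k -> last_sum n (h * k * h' * gen F y) = 0.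
Proof.
move=> [hk qk]; have {}qk : k + sigma g q 0 k = 0 by rewrite -qsym2E.
pose L f f' := last_sum n (f * k * f' * gen F y).
have L1 f' : linear (L^~ f').
  move=> a u v; apply: (etrans (f_equal (last_sum n) _) (last_sum_linear n _ _ _)).
  by rewrite !mulr_linl.
have L2 f : linear (L f).
  move=> a u v; apply: (etrans (f_equal (last_sum n) _) (last_sum_linear n _ _ _)).
  exact: (etrans (f_equal (fun t => t * gen F y) (mulr_linr _ _ _ _)) (mulr_linl _ _ _ _)).
rewrite -/(L h h'); apply: (word_lin_eq (h := L^~ h') (h' := fun=> 0)) => [//||u].
  exact: zero_linear.
apply: (word_lin_eq (h := L (word F u)) (h' := fun=> 0)) => [//||v].
  exact: zero_linear.
rewrite /L /last_sum; set w := _ * gen F y.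
pose N := (size u + 2 + size v + 1)%N.
pose P2 f' := word F u * f' * word F v * gen F y.
have P2l : linear P2 by move=> a f1 f2; rewrite /P2 (mulr_linr (word F u)) !mulr_linl.
have hw : homog_deg N w.
  apply: (homog_ind (S := [set f' | homog_deg N (P2 f')]) _ _ hk).
    split=> [|a f1 f2 /= h1 h2].
      by rewrite /= (linear_fun0 P2l); apply: subspace0; apply: homog_subspace.
    by rewrite P2l; apply: (homog_subspace F A N).2.
  move=> s s2; rewrite /= /P2 !wordM.
  have -> : N = size (((u ++ s) ++ v) ++ [:: y]) by rewrite !size_cat s2.
  exact: homog_word.
have [nN|nN] := eqVneq n.+1 N; last first.
  rewrite big1 // => x _; rewrite (homog_ncomp_neq hw nN).
  exact: (linear_fun0 (braid_lift_linear g q x)).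
have un : (size u < n)%N by move: nN; rewrite /N; lia.
have un1 : ((size u).+1 < n)%N by move: nN; rewrite /N; lia.
rewrite -nN in hw; rewrite (homogP n.+1 w).1 //.
pose i := Ordinal un; pose Y := [set x : 'S_n.+1 | x ord_max == ord_max]%SET.
have YE (x : 'S_n.+1) : (x ord_max == ord_max) = (x \in Y) by rewrite inE.
under eq_bigl => x do rewrite YE.
have Yi (x : 'S_n.+1) : x \in Y -> (x * adj i)%g \in Y.
  rewrite !inE permM => /eqP ->; rewrite adj_out //=; first by lia.
  by lia.
have sP : sigma g q i w = P2 (sigma g q 0 k).
  have l1 : linear (fun f' => sigma g q i (P2 f')).
    by move=> a f1 f2; rewrite P2l sigma_lin.
  have l2 : linear (fun f' => P2 (sigma g q 0 f')).
    by move=> a f1 f2; rewrite sigma_lin P2l.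
  apply: (homog_lin_eq l1 l2 _ hk) => -[|a [|b []]] // _.
  have -> : P2 (word F [:: a; b]) = word F (u ++ a :: b :: rcons v y).
    by rewrite /P2 !wordM -!catA -cats1.
  rewrite sigma_word // (sigma_word g q (i := 0) (u := [::])) //.
  rewrite (linearZ_fun _ _ P2l) /P2 !wordM -!catA -cats1.
  by [].
have ww : w + sigma g q i w = 0.
  rewrite sP; apply: (etrans (esym (linearD_fun k (sigma g q 0 k) P2l))).
  by rewrite qk (linear_fun0 P2l).
exact: (sum_braid_lift_pair gD Yi hw ww).
Qed.

End Primitive.

Section PrimitiveInNichols.
Variables (F : fieldType) (A : finZmodType) (g : {perm A}) (q : F).
Hypothesis gD : {morph g : x y / x + y}.
Implicit Types (f h : talg F A) (s u v : seq A).

(** The ideal generated by the kernel of [Q_2] is spanned by the products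
    [h * k * h']. *)
Lemma J2_min (P : talg F A -> Prop) : is_subspace P ->
  (forall k h h', kerQ2 g q k -> P (h * k * h')) -> forall f, J2 g q f -> P f.
Proof.
move=> PP Pk f Jf; pose P' := [set f | forall h h', P (h * f * h')].
suff /(_ 1 1) : P' f by rewrite mul1r mulr1.
apply: Jf; split=> [|k Kk h h']; last exact: Pk.
split=> [|u w Pu]; last first.
  by split=> h h'; [rewrite mulrA | rewrite mulrA -[h * u * w * h']mulrA]; apply: Pu.
split=> [h h'|a u v Pu Pv h h']; first by rewrite mulr0 mul0r; apply: subspace0.
rewrite (mulr_linr h) mulr_linl; apply: PP.2; [exact: Pu | exact: Pv].
Qed.

Lemma J2_last_sum n f y : J2 g q f -> last_sum g q n (f * gen F y) = 0.
Proof.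
apply: (J2_min (P := fun f => last_sum g q n (f * gen F y) = 0)).
  apply: (eq_subspace (h := fun f => last_sum g q n (f * gen F y)) (h' := fun=> 0)).
    move=> a u v; apply: (etrans (f_equal (last_sum g q n) _) (last_sum_linear g q n _ _ _)).
    exact: mulr_linl.
  exact: zero_linear.
by move=> k h h' Kk; apply: last_sum_ideal.
Qed.

Lemma J2_ncomp1 f : J2 g q f -> ncomp 1 f = 0.
Proof.
apply: (J2_min (P := fun f => ncomp 1 f = 0)).
  apply: (eq_subspace (h := fun f => ncomp 1 f) (h' := fun=> 0)).
    by move=> a u v; apply: ncomp_lin.
  exact: zero_linear.
move=> k h h' [hk _]; have zl := @zero_linear F (talg F A) (talg F A).
apply: (word_lin_eq (h := fun h => ncomp 1 (h * k * h')) (h' := fun=> 0)) => [a u v||u].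
- by rewrite !mulr_linl ncomp_lin.
- exact: zl.
apply: (word_lin_eq (h := fun h' => ncomp 1 (word F u * k * h')) (h' := fun=> 0)) => [a v w||v].
- by rewrite mulr_linr ncomp_lin.
- exact: zl.
apply: (homog_lin_eq (h := fun k => ncomp 1 (word F u * k * word F v)) (h' := fun=> 0) _ _ _ hk).
- by move=> a f1 f2; rewrite (mulr_linr (word F u)) mulr_linl ncomp_lin.
- exact: zl.
move=> s s2; rewrite !wordM ncomp_word !size_cat s2.
by case: eqP => //; lia.
Qed.

Lemma ncomp1_last_sum n f b : J2 g q f -> last_sum g q n (f * ncomp 1 b) = 0.
Proof.
move=> Jf.
apply: (word_lin_eq (h := fun b => last_sum g q n (f * ncomp 1 b)) (h' := fun=> 0)) => [a u v||s].
- apply: (etrans (f_equal (last_sum g q n) _) (last_sum_linear g q n _ _ _)).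
  by rewrite ncomp_lin mulr_linr.
- exact: zero_linear.
rewrite ncomp_word; case: s => [|y [|z s]] /=; last first.
- by rewrite mulr0 (linear_fun0 (last_sum_linear g q n)).
- exact: J2_last_sum.
by rewrite mulr0 (linear_fun0 (last_sum_linear g q n)).
Qed.

(** Only components of degree one on the right enter the quantum symmetrizer;
    those of [f (x) 1] and [1 (x) f] vanish since [f] has degree at least two, and
    those of the tensor kernel of [J2] lie in [J2 V], because [J2] starts in
    degree two. *)
Lemma primitive_nichols N f : (2 <= N)%N -> homog_deg N f ->
  primitive_mod g q (J2 g q) f -> nichols_ideal g q f.
Proof.
move=> N2 hf pf n; have [->|nN] := eqVneq n N; last first.
  rewrite (homog_ncomp_neq hf nN); case: n {nN} => [//|n] /=.
  by apply: big1 => x _; apply: (linear_fun0 (braid_lift_linear g q x)).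
rewrite (homogP N f).1 //; case: N => [//|m] in N2 hf *.
rewrite (qsym_last_part q gD hf).
pose L t := last_sum g q m (last_part t).
have Ll : linear L.
  move=> a u v; apply: (etrans (f_equal (last_sum g q m) _) (last_sum_linear g q m _ _ _)).
  exact: last_part_lin.
have : tens_ker (J2 g q) `<=` [set t | L t = 0].
  apply: tens_ker_min => [|a b Ja|a b Jb] /=.
  - exact: (eq_subspace Ll (@zero_linear F _ _)).
  - by rewrite /L last_part_tens ncomp1_last_sum.
  by rewrite /L last_part_tens J2_ncomp1 // mulr0 (linear_fun0 (last_sum_linear g q m)).
move=> /(_ _ pf) /=.
rewrite (linearB_fun _ _ Ll) (linearD_fun _ _ Ll).
have z1 : L (tens f 1) = 0.
  rewrite /L last_part_tens word1 ncomp_word /= mulr0.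
  exact: (linear_fun0 (last_sum_linear g q m)).
have z2 : L (tens 1 f) = 0.
  rewrite /L last_part_tens (homog_ncomp_neq hf) ?mulr0; last by case: (m) N2.
  exact: (linear_fun0 (last_sum_linear g q m)).
move=> /subr0_eq e; apply: (etrans e); apply: (etrans (f_equal2 +%R z1 z2)).
exact: addr0.
Qed.

End PrimitiveInNichols.

(** * Chains and quadratic relations *)

Section Chains.
Variables (A : finZmodType) (g : {perm A}).
Hypothesis gD : {morph g : x y / x + y}.
Implicit Types (p : A * A) (D : {set A * A}).

(** The permutation of [A * A] that underlies the braiding. *)
Definition next_pair p := (affop g p.1 p.2, p.1).

Lemma next_pair_inj : injective next_pair.
Proof.
by case=> a b [a' b'] [ab a'E]; rewrite /= in ab a'E; rewrite -a'E in ab *; rewrite (affop_inj ab).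
Qed.

Lemma iter_next_pair k p :
  iter k next_pair p = (xs g p.2 p.1 k.+2, xs g p.2 p.1 k.+1).
Proof. by elim: k => [|k IH]; [case: p | rewrite iterS IH]. Qed.

Lemma chain_relE : chain_rel g =2 fconnect next_pair.
Proof.
move=> p p'; apply/asboolP/idP => [[m [m2 ->]]|/iter_findex <-].
  by case: m m2 => [|[|k]] // _; rewrite -iter_next_pair fconnect_iter.
by exists (findex next_pair p p').+2; rewrite iter_next_pair.
Qed.

Lemma chain_rel_equiv : equivalence_rel (chain_rel g).
Proof.
move=> p p' p''; rewrite !chain_relE connect0; split=> // pp'.
exact: (same_connect (fconnect_sym next_pair_inj) pp').
Qed.

Lemma iter_next_pair_diff k p : let p' := iter k next_pair p in
  p'.1 - p'.2 = iter k (fun a => - g a) (p.1 - p.2) /\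
  p'.2 = p.2 + alt_sum g k (p.1 - p.2).
Proof.
have gN := additive_funN gD.
elim: k => [|k [IH1 IH2]] /=; first by rewrite /alt_sum big_ord0 addr0.
split; first by rewrite -IH1 /affop addrAC subrr add0r -gN opprB.
by rewrite /alt_sum big_ord_recr /= -/(alt_sum _ _ _) addrA -IH2 -IH1 addrC subrK.
Qed.

(** If the alternating sum [S] of [n] terms kills [d], then [S d + (- g)^n d] is
    both [(- g)^n d] and [d - g (S d) = d], so the chain returns to the pair and
    not only to its second component. *)
Lemma iter_next_pair_id k p :
  (iter k next_pair p == p) = (alt_sum g k (p.1 - p.2) == 0).
Proof.
have [e1 e2] := iter_next_pair_diff k p; apply/eqP/eqP => [pp|s0].
  by move: e2; rewrite pp => /esym/(canRL (addKr _)); rewrite addNr.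
have sS h : (forall a b, h (a + b) = h a + h b) -> forall m d,
    \sum_(i < m.+1) iter i h d = d + h (\sum_(i < m) iter i h d) :> A.
  move=> hD m d; rewrite big_ord_recl; congr (_ + _).
  have h0 : h 0 = 0 by apply: additive_fun0.
  by rewrite (big_morph h hD h0).
have hD a b : - g (a + b) = - g a - g b by rewrite gD opprD.
have := sS _ hD k (p.1 - p.2); rewrite big_ord_recr /= -/(alt_sum _ _ _) s0 add0r.
have g0 := additive_fun0 gD.
rewrite g0 oppr0 addr0 -e1 e2 s0 addr0 => /addIr e1'.
by rewrite [LHS]surjective_pairing e1' e2 s0 addr0 -surjective_pairing.
Qed.

Lemma chain_lenE p : chain_len g (p.1 - p.2) = fingraph.order next_pair p.
Proof.
rewrite /chain_len; case: ex_minnP => n /andP[n0]; rewrite -iter_next_pair_id => /eqP np min.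
apply/eqP; rewrite eqn_leq; apply/andP; split.
  apply: min; rewrite fingraph.order_gt0 -iter_next_pair_id.
  by rewrite fingraph.iter_order ?eqxx //; apply: next_pair_inj.
rewrite leqNgt; apply/negP => nlt; have := orbit_uniq next_pair p.
have op := fingraph.order_gt0 next_pair p.
move/(nth_uniq p (i := n) (j := 0)).
by rewrite size_traject !nth_traject // => /(_ nlt op); rewrite /= np eqxx; case: n n0 {nlt np min}.
Qed.

End Chains.

Section QuadraticRelations.
Variables (F : fieldType) (A : finZmodType) (g : {perm A}) (q : F).
Hypothesis gD : {morph g : x y / x + y}.
Implicit Types (p : A * A) (f : talg F A).

Local Notation T := (next_pair g).
Local Notation ord := (fingraph.order (next_pair g)).

Definition pair_word p : talg F A := word F [:: p.1; p.2].

Definition pair_coef f p : F := f@_(FMonom [:: p.1; p.2]).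

Lemma pair_coef_lin p : linear (fun f => pair_coef f p : F^o).
Proof. by move=> a u v; rewrite /pair_coef mcoeffD mcoeffZ. Qed.

Lemma pair_coef_word p p' : pair_coef (pair_word p) p' = (p == p')%:R.
Proof.
rewrite /pair_coef /pair_word word_coef.
by case: p p' => a b [a' b'] /=; rewrite xpair_eqE !eqseq_cons andbT.
Qed.

Lemma homog_pair_word p : homog_deg 2 (pair_word p).
Proof. exact: homog_word. Qed.

Lemma homog2E f : homog_deg 2 f -> f = \sum_p pair_coef f p *: pair_word p.
Proof.
have l1 : linear (fun f : talg F A => f) by [].
have l2 : linear (fun f : talg F A => \sum_p pair_coef f p *: pair_word p).
  move=> a u v; rewrite scaler_sumr -big_split; apply: eq_bigr => p _ /=.
  by rewrite (pair_coef_lin p) scalerDl scalerA.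
apply: (homog_lin_eq l1 l2) => -[|a [|b []]] // _.
rewrite -[word F _]/(pair_word (a, b)) (bigD1 (a, b)) //= big1 => [|p pab].
  by rewrite pair_coef_word eqxx scale1r addr0.
by rewrite pair_coef_word eq_sym (negPf pab) scale0r.
Qed.

Lemma pair_coef_eq f f' : homog_deg 2 f -> homog_deg 2 f' ->
  pair_coef f =1 pair_coef f' -> f = f'.
Proof.
move=> hf hf' ff'; rewrite (homog2E hf) (homog2E hf').
by apply: eq_bigr => p _; rewrite ff'.
Qed.

Lemma sigma_pair_word p : sigma g q 0 (pair_word p) = q *: pair_word (T p).
Proof. by apply: (@sigma_word _ _ g q 0 [::]). Qed.

Lemma pair_coef_sigma f p : homog_deg 2 f ->
  pair_coef (sigma g q 0 f) (T p) = q * pair_coef f p.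
Proof.
have l1 : linear (fun f => pair_coef (sigma g q 0 f) (T p) : F^o).
  by move=> a u v; rewrite sigma_lin (pair_coef_lin (T p)).
have l2 : linear (fun f => q * pair_coef f p : F^o).
  by move=> a u v; rewrite (pair_coef_lin p) /= mulrDr /GRing.scale /= mulrCA.
apply: (homog_lin_eq l1 l2) => -[|a [|b []]] // _.
rewrite -[word F _]/(pair_word (a, b)) sigma_pair_word.
rewrite (linearZ_fun _ _ (pair_coef_lin _)) !pair_coef_word /GRing.scale /=.
by rewrite (inj_eq (@next_pair_inj A g)).
Qed.

Lemma nichols_rel2P f :
  nichols_rel2 g q f <-> homog_deg 2 f /\ f + sigma g q 0 f = 0.
Proof.
split=> -[hf ff]; split=> //.
  by have := ff 2%N; rewrite (homogP 2 f).1 // qsym2E.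
move=> n; have [->|n2] := eqVneq n 2; first by rewrite (homogP 2 f).1 // qsym2E.
rewrite (homog_ncomp_neq hf n2); case: n {n2} => // n; apply: big1 => x _.
exact: (linear_fun0 (braid_lift_linear g q x)).
Qed.

(** The geometric sequences along orbits. *)
Lemma rel2_coef f p : nichols_rel2 g q f -> pair_coef f (T p) = - q * pair_coef f p.
Proof.
move=> /nichols_rel2P[hf ff]; apply/eqP; rewrite mulNr -addr_eq0 -pair_coef_sigma //.
by rewrite -(linearD_fun _ _ (pair_coef_lin (T p))) ff (linear_fun0 (pair_coef_lin (T p))).
Qed.

Lemma rel2_coef_iter f p k : nichols_rel2 g q f ->
  pair_coef f (iter k T p) = (- q) ^+ k * pair_coef f p.
Proof.
move=> rf; elim: k => [|k IH]; first by rewrite mul1r.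
by rewrite iterS rel2_coef // IH mulrA exprS.
Qed.

Lemma rel2_subspace : is_subspace (nichols_rel2 g q).
Proof.
split=> [|a u v /nichols_rel2P[hu uu] /nichols_rel2P[hv vv]]; apply/nichols_rel2P.
  by split; [apply: (homog_subspace F A 2).1 | rewrite linear0 addr0].
split; first exact: (homog_subspace F A 2).2.
by rewrite sigma_lin addrACA -scalerDr uu vv scaler0 addr0.
Qed.

Lemma qchainE p : qchain g q p =
  \sum_(i < ord p) (- q) ^+ i *: pair_word (iter i T p).
Proof.
rewrite /qchain (chain_lenE gD).
have o0 : (0 < ord p)%N by apply: fingraph.order_gt0.
rewrite -(prednK o0) big_ord_recr /= big_add1 /= big_add1 /= big_mkord.
apply: (f_equal2 +%R).
  apply: eq_bigr => i _; rewrite iter_next_pair subn2 /=.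
  exact: (f_equal ( *:%R _) (wordM _ _ _)).
rewrite iter_next_pair; apply: (f_equal ( *:%R _)); apply: (etrans (wordM _ _ _)).
have := fingraph.iter_order (@next_pair_inj A g) p; rewrite -(prednK o0) iter_next_pair.
by move=> /(congr1 snd) /= e; rewrite /pair_word /= e.
Qed.

End QuadraticRelations.

Section ChainBasis.
Variables (F : fieldType) (A : finZmodType) (g : {perm A}) (q : F).
Hypothesis gD : {morph g : x y / x + y}.
Implicit Types (p : A * A) (f : talg F A).

Local Notation T := (next_pair g).
Local Notation ord := (fingraph.order (next_pair g)).

Lemma cycle_rel2 p n : iter n T p = p -> (- q) ^+ n = 1 ->
  nichols_rel2 g q (\sum_(i < n) (- q) ^+ i *: pair_word F (iter i T p)).
Proof.
move=> pn qn; apply/nichols_rel2P => //; split.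
  apply: (subspace_sum _ (homog_subspace F A 2)) => i _.
  by apply: (subspaceZ _ (homog_subspace F A 2)); apply: homog_pair_word.
pose a i : talg F A := (- q) ^+ i *: pair_word F (iter i T p).
have sa i : sigma g q 0 (a i) = - a i.+1.
  rewrite /a sigmaZ sigma_pair_word scalerA iterS -scaleNr exprSr mulrN opprK.
  by [].
have -> : sigma g q 0 (\sum_(i < n) a i) = \sum_(i < n) - a i.+1.
  rewrite (linear_sum_fun _ _ _ (sigma_lin g q 0)).
  by apply: eq_bigr => i _; apply: sa.
rewrite -big_split /= -(big_mkord xpredT (fun i => a i - a i.+1)).
under eq_bigr => i _ do rewrite -opprB.
by rewrite sumrN telescope_sumr // /a qn pn expr0 subrr oppr0.
Qed.

Lemma qchain_rel2 p : (- q) ^+ ord p = 1 -> nichols_rel2 g q (qchain g q p).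
Proof.
move=> qp; rewrite qchainE //; apply: cycle_rel2 => //.
by rewrite fingraph.iter_order //; apply: next_pair_inj.
Qed.

Lemma pair_coef_qchain p (i : nat) : (i < ord p)%N ->
  pair_coef (qchain g q p) (iter i T p) = (- q) ^+ i.
Proof.
move=> ip; rewrite qchainE // (linear_sum_fun _ _ _ (pair_coef_lin _)).
rewrite (bigD1 (Ordinal ip)) //= big1 => [|j ji].
  rewrite (linearZ_fun _ _ (pair_coef_lin _)) pair_coef_word eqxx addr0.
  exact: mulr1.
rewrite (linearZ_fun _ _ (pair_coef_lin _)) pair_coef_word.
have := orbit_uniq T p; move/(nth_uniq p (i := j) (j := i)).
rewrite size_traject !nth_traject // => /(_ (ltn_ord j) ip) ->.
rewrite -val_eqE /= in ji; rewrite (negPf ji); exact: mulr0.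
Qed.

Lemma pair_coef_qchain0 p p' : ~~ fconnect T p p' -> pair_coef (qchain g q p) p' = 0.
Proof.
move=> pp'; rewrite qchainE // (linear_sum_fun _ _ _ (pair_coef_lin _)).
apply: big1 => i _; rewrite (linearZ_fun _ _ (pair_coef_lin _)) pair_coef_word.
case: eqP pp' => [<-|_ _]; first by rewrite fconnect_iter.
exact: mulr0.
Qed.

(** Going once around the orbit multiplies the coefficient by a factor other
    than one. *)
Lemma rel2_coef0 f p : nichols_rel2 g q f -> (- q) ^+ ord p != 1 -> pair_coef f p = 0.
Proof.
move=> rf qp; have := rel2_coef_iter gD p (ord p) rf.
rewrite fingraph.iter_order; last exact: next_pair_inj.
move=> /eqP; rewrite -subr_eq0 -{1}[pair_coef f p]mul1r -mulrBl mulf_eq0.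
by rewrite subr_eq0 eq_sym (negPf qp) => /eqP.
Qed.

Lemma rel2_eq f f' : nichols_rel2 g q f -> nichols_rel2 g q f' ->
  (forall p, (- q) ^+ ord p = 1 ->
    exists2 p0, fconnect T p0 p & pair_coef f p0 = pair_coef f' p0) -> f = f'.
Proof.
move=> rf rf' ff'; apply: pair_coef_eq; [exact: rf.1 | exact: rf'.1 | move=> p].
have [/ff'[p0 pp0 e]|qp] := eqVneq ((- q) ^+ ord p) 1; last by rewrite !rel2_coef0.
rewrite -(iter_findex pp0) (rel2_coef_iter gD p0 _ rf).
by rewrite (rel2_coef_iter gD p0 _ rf') e.
Qed.

(** On [X], the coefficients of the chains form the identity matrix, and an
    element of the kernel is determined by its coefficients on [X]. *)
Theorem qchain_basis (D X : {set A * A}) :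
  (forall p, (p \in D) = ((- q) ^+ ord p == 1)) ->
  is_transversal X (chain_classes g D) D ->
  is_basis (nichols_rel2 g q) [seq qchain g q p | p <- enum X].
Proof.
move=> DE trX; have eqv : {in D & &, equivalence_rel (chain_rel g)}.
  by move=> p p' p'' _ _ _; apply: chain_rel_equiv.
have XD p : p \in X -> p \in D by exact: (fintype.subsetP (transversal_sub trX) p).
have part := equivalence_partitionP eqv.
have X_inj p p' : p \in X -> p' \in X -> fconnect T p p' -> p = p'.
  move=> Xp Xp' pp'; apply: (pblock_inj trX) => //.
  apply/esym/same_pblock; first by case/and3P: part.
  by rewrite pblock_equivalence_partition ?XD // chain_relE.
have X_ex p : p \in D -> exists2 p0, p0 \in X & fconnect T p0 p.
  move=> Dp; pose P := chain_classes g D; have cP : finset.cover P = D by case/and3P: part => /eqP.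
  have BP : finset.pblock P p \in P by rewrite finset.pblock_mem ?cP.
  exists (transversal_repr p X (finset.pblock P p)); first exact: (repr_mem_transversal trX p BP).
  have := repr_mem_pblock trX p BP; set p0 := transversal_repr _ _ _ => p0B.
  have Dp0 : p0 \in D by apply: (XD _ (repr_mem_transversal trX p BP)).
  rewrite fconnect_sym; last exact: next_pair_inj.
  by rewrite -chain_relE -(pblock_equivalence_partition eqv).
have coefX p p' : p \in X -> p' \in X -> pair_coef (qchain g q p) p' = (p == p')%:R.
  move=> Xp Xp'; have [<-|pp'] := eqVneq p p'.
    exact: (pair_coef_qchain (fingraph.order_gt0 T p)).
  by apply: pair_coef_qchain0; apply: contra pp' => /X_inj ->.
have relX p : p \in X -> nichols_rel2 g q (qchain g q p).
  by move=> /XD; rewrite DE => /eqP; apply: qchain_rel2.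
have inj : {in X &, injective (qchain g q)}.
  move=> p p' Xp Xp' /(f_equal (fun f => pair_coef f p)) pp'; apply/eqP.
  move: (etrans (esym (coefX p p Xp Xp)) (etrans pp' (coefX p' p Xp' Xp))).
  move=> {pp'}; rewrite (eqxx p) (eq_sym p); case: (p' == p) => // /eqP.
  by rewrite oner_eq0.
have sumE (c : A * A -> F) p0 : p0 \in X ->
    pair_coef (\sum_(p <- enum X) c p *: qchain g q p) p0 = c p0.
  move=> Xp0; rewrite (linear_sum_fun _ _ _ (pair_coef_lin p0)) big_enum /=.
  rewrite (bigD1 p0) //= big1 => [|p /andP[Xp pp0]].
    rewrite (linearZ_fun _ _ (pair_coef_lin _)) coefX // eqxx addr0; exact: mulr1.
  rewrite (linearZ_fun _ _ (pair_coef_lin _)) coefX // (negPf pp0); exact: mulr0.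
split; first split.
- rewrite map_inj_in_uniq; first exact: enum_uniq.
  move=> p p' Xp Xp'; apply: inj.
    by rewrite mem_enum in Xp.
  by rewrite mem_enum in Xp'.
- move=> a; rewrite big_map => s0 v /mapP[p0]; rewrite mem_enum => Xp0 ->.
  have := sumE (fun p => a (qchain g q p)) p0 Xp0.
  by rewrite s0 (linear_fun0 (pair_coef_lin p0)).
apply/seteqP; split; last first.
  apply: lin_span_min; first exact: rel2_subspace.
  by move=> _ /= /mapP[p0 Xp0 ->]; rewrite mem_enum in Xp0; apply: relX.
move=> f rf; pose f' := \sum_(p <- enum X) pair_coef f p *: qchain g q p.
have rf' : nichols_rel2 g q f'.
  rewrite /f' big_enum; apply: (subspace_sum _ (@rel2_subspace F A g q gD)) => p Xp.
  by apply: (subspaceZ _ (@rel2_subspace F A g q gD)); apply: relX.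
have -> : f = f'.
  apply: rel2_eq => // p /eqP; rewrite -DE => /X_ex[p0 Xp0 pp0].
  by exists p0; rewrite // /f' sumE.
rewrite /f' big_seq; apply: (subspace_sum _ (lin_span_subspace _)) => p Xp.
apply: (subspaceZ _ (lin_span_subspace _)); apply: sub_lin_span.
by rewrite /=; apply: map_f.
Qed.

End ChainBasis.

Section ChainsMinusOne.
Variables (F : fieldType) (A : finZmodType) (g : {perm A}).
Hypothesis gD : {morph g : x y / x + y}.

Lemma chain_qchain p : chain F g p = qchain g (-1) p.
Proof.
rewrite /chain /qchain opprK expr1n scale1r; apply: (f_equal (fun t => t + _)).
by apply: eq_bigr => i _; rewrite expr1n scale1r.
Qed.

Lemma chain_rel2 p : nichols_rel2 g (-1) (chain F g p).
Proof. by rewrite chain_qchain; apply: qchain_rel2; rewrite // opprK expr1n. Qed.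

Lemma chain_eq p p' : chain_rel g p p' -> chain F g p = chain F g p'.
Proof.
rewrite chain_relE => pp'; apply: (rel2_eq gD (chain_rel2 p) (chain_rel2 p')) => p1 _.
have coef1 r i : pair_coef (chain F g r) (iter i (next_pair g) r) = 1.
  rewrite (rel2_coef_iter gD _ _ (chain_rel2 r)) opprK expr1n mul1r chain_qchain.
  exact: (pair_coef_qchain _ gD (fingraph.order_gt0 (next_pair g) r)).
have coefE r r' : pair_coef (chain F g r) r' = (fconnect (next_pair g) r r')%:R.
  have [/iter_findex <-|rr'] := boolP (fconnect _ r r'); first exact: coef1.
  by rewrite chain_qchain pair_coef_qchain0.
exists p1; first exact: connect0.
apply: (etrans (coefE _ _)); apply: etrans (esym (coefE _ _)).
by rewrite (same_connect (fconnect_sym (@next_pair_inj A g)) pp').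
Qed.

(** A chain with [q = -1] has the same coefficient at all pairs of its orbit, so
    it depends on the orbit only. *)
Theorem chain_basis :
  is_basis (nichols_rel2 g (-1)) (undup [seq chain F g p | p : A * A]) /\
  has_dim (@nichols_rel2 F A g (-1)) #|chain_classes g [set: A * A]%SET|.
Proof.
have eqv : {in [set: A * A]%SET & &, equivalence_rel (chain_rel g)}.
  by move=> p p' p'' _ _ _; apply: chain_rel_equiv.
have trX := transversalP (equivalence_partitionP eqv).
set X := transversal _ _ in trX.
have DE p : (p \in [set: A * A]%SET) = ((- - 1 : F) ^+ fingraph.order (next_pair g) p == 1).
  by rewrite inE opprK expr1n eqxx.
have B := qchain_basis gD DE trX.
split; last first.
  exists [seq qchain g (-1) p | p <- enum X] => //.
  by rewrite size_map -cardE (card_transversal trX).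
have memE : [seq qchain g (-1) p | p <- enum X] =i undup [seq chain F g p | p : A * A].
  move=> f; rewrite mem_undup; apply/mapP/mapP => [[p _ ->]|[p _ ->]].
    by exists p; rewrite ?mem_enum ?chain_qchain.
  pose P := chain_classes g [set: A * A]%SET.
  have cP : finset.cover P = [set: A * A]%SET by case/and3P: (equivalence_partitionP eqv) => /eqP.
  have BP : finset.pblock P p \in P by rewrite finset.pblock_mem ?cP ?inE.
  have Xp0 := repr_mem_transversal trX p BP.
  have := repr_mem_pblock trX p BP; set p0 := transversal_repr _ _ _ in Xp0 *.
  rewrite (pblock_equivalence_partition eqv) ?in_setT // => pp0.
  exists p0; first by rewrite mem_enum.
  by rewrite -chain_qchain; apply: chain_eq.
case: B => -[u ind] sp; split.
  2: by rewrite sp; congr lin_span; apply/seteqP; split=> f /=; rewrite memE.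
have pe : perm_eq [seq qchain g (-1) p | p <- enum X] (undup [seq chain F g p | p : A * A]).
  by apply: uniq_perm; rewrite // undup_uniq.
split; first exact: undup_uniq.
move=> a; rewrite -(perm_big _ pe) /= => /ind a0 v; rewrite -memE; exact: a0.
Qed.

End ChainsMinusOne.

(** * Twisting by a letter *)

Section Twist.
Variables (F : fieldType) (A : finZmodType) (g : {perm A}) (q : F).
Hypothesis gD : {morph g : x y / x + y}.
Implicit Types (f h a b : talg F A) (s t : seq A) (x y z : A).

Local Notation K := (twist g q).

Lemma phiE x y : phi g x y = affop g x y. Proof. exact: permE. Qed.

Lemma phi_conj x y : (phi g y * phi g x = phi g x * phi g (phi g x y))%g.
Proof. by apply/permP => z; rewrite !permM !phiE affop_distr. Qed.

Lemma wdeg_cons x s : wdeg g (FMonom (x :: s)) = (wdeg g (FMonom s) * phi g x)%g.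
Proof. by []. Qed.

Lemma wdeg_rcons x s :
  wdeg g (FMonom (rcons s x)) = (phi g x * wdeg g (FMonom s))%g.
Proof.
by elim: s => [|y s IH]; rewrite /= ?wdeg_cons ?IH ?mulgA // /wdeg /= mulg1 mul1g.
Qed.

Lemma wdeg_map x s :
  (wdeg g (FMonom s) * phi g x = phi g x * wdeg g (FMonom (map (phi g x) s)))%g.
Proof.
elim: s => [|y s IH]; first by rewrite /wdeg /= mulg1 mul1g.
by rewrite wdeg_cons -mulgA phi_conj mulgA IH -mulgA -wdeg_cons.
Qed.

Lemma twist1 x : K x (word F [::]) = word F [::].
Proof. by rewrite twist_word scale1r. Qed.

Lemma twistM_gen x y f : K x (gen F y * f) = q *: (gen F (phi g x y) * K x f).
Proof.
have l1 : linear (fun f => K x (gen F y * f)).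
  by move=> a u v; rewrite mulr_linr twist_lin.
have l2 : linear (fun f => q *: (gen F (phi g x y) * K x f)).
  by move=> a u v; rewrite twist_lin mulr_linr scalerDr !scalerA mulrC.
apply: (word_lin_eq l1 l2) => s; rewrite -word_cons !twist_word mulr_scaler -word_cons.
by rewrite scalerA exprS.
Qed.

Lemma twist_twist x y f : K x (K y f) = K (phi g x y) (K x f).
Proof.
have l1 : linear (fun f => K x (K y f)) by move=> a u v; rewrite !twist_lin.
have l2 : linear (fun f => K (phi g x y) (K x f)) by move=> a u v; rewrite !twist_lin.
apply: (word_lin_eq l1 l2) => s; rewrite !twist_word.
rewrite !(linearZ_fun _ _ (twist_lin _ _ _)) !twist_word !size_map -!map_comp.
rewrite (eq_map (g := phi g (phi g x y) \o phi g x)) // => z /=.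
by rewrite -!permM phi_conj.
Qed.

Lemma counit_twist x f : counit (K x f) = counit f.
Proof.
have l1 : linear (fun f => counit (K x f) : F^o).
  by move=> a u v; rewrite twist_lin counit_lin.
have l2 : linear (fun f : talg F A => counit f : F^o).
  by move=> a u v; rewrite counit_lin.
apply: (word_lin_eq l1 l2) => s.
rewrite twist_word counitZ !counit_word.
by case: s => [|y s]; rewrite /= ?mulr0 // expr0 mul1r.
Qed.

(** [twist x] on the tensor square; it commutes with the coproduct because
    [twist] is an automorphism of the braided algebra. *)
Definition twist2 x : talg2 F A -> talg2 F A :=
  linext (fun k : {fmonom A} * {fmonom A} => tens (K x << k.1 >>) (K x << k.2 >>)).

Lemma twist2_lin x : linear (twist2 x). Proof. exact: linearP. Qed.

Lemma twist2_tens x a b : twist2 x (tens a b) = tens (K x a) (K x b).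
Proof.
apply: (tens_lin2_eq (b := fun a b => tens (K x a) (K x b))) => [||f c u v|s t].
- exact: twist2_lin.
- by move=> f c u v; rewrite twist_lin tens_linr.
- by rewrite twist_lin tens_linl.
by rewrite [in LHS]tens_word; apply: linextU.
Qed.

Lemma twist2_left x y (t : talg2 F A) :
  twist2 x (left_letter y t) = q *: left_letter (phi g x y) (twist2 x t).
Proof.
have l1 : linear (fun t : talg2 F A => twist2 x (left_letter y t)).
  by move=> a u v; rewrite left_letter_lin twist2_lin.
have l2 : linear (fun t : talg2 F A => q *: left_letter (phi g x y) (twist2 x t)).
  by move=> a u v; rewrite twist2_lin left_letter_lin scalerDr !scalerA mulrC.
apply: (tens_lin_eq l1 l2) => u v; rewrite left_letter_tens.
apply: (etrans (twist2_tens _ _ _)); rewrite twistM_gen tensZl.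
apply: (f_equal ( *:%R _)); rewrite twist2_tens.
exact: esym (left_letter_tens _ _ _).
Qed.

Lemma twist2_right x y (t : talg2 F A) :
  twist2 x (right_letter g q y t) =
  q *: right_letter g q (phi g x y) (twist2 x t).
Proof.
have l1 : linear (fun t : talg2 F A => twist2 x (right_letter g q y t)).
  by move=> a u v; rewrite right_letter_lin twist2_lin.
have l2 : linear (fun t : talg2 F A => q *: right_letter g q (phi g x y) (twist2 x t)).
  by move=> a u v; rewrite twist2_lin right_letter_lin scalerDr !scalerA mulrC.
apply: (tens_lin_eq l1 l2) => u v; rewrite right_letter_tens.
apply: (etrans (twist2_tens _ _ _)); rewrite twistM_gen twist_twist.
rewrite (linearZ_fun _ _ (tens_is_linear _)).
apply: (f_equal ( *:%R _)); rewrite twist2_tens.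
exact: esym (right_letter_tens _ _ _ _ _).
Qed.

Lemma comul_twist x f : comul g q (K x f) = twist2 x (comul g q f).
Proof.
have l1 : linear (fun f => comul g q (K x f)).
  by move=> a u v; rewrite twist_lin comul_lin.
have l2 : linear (fun f => twist2 x (comul g q f)).
  by move=> a u v; rewrite comul_lin twist2_lin.
apply: (word_lin_eq l1 l2); elim=> [|y s IH].
  rewrite twist1 comul_word /= twist2_tens.
  by rewrite (_ : K x 1 = 1) // word1 twist1.
rewrite {1}word_cons twistM_gen (linearZ_fun _ _ (comul_lin g q)) comulM_gen IH.
rewrite comul_cons (linearD_fun _ _ (twist2_lin x)) scalerDr.
by apply: (f_equal2 +%R); [rewrite twist2_left | rewrite twist2_right].
Qed.

(** The right multiplications by [x (x) 1] and by [1 (x) x]: in the first one,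
    [x] has to pass the right factor, which acts on it by its degree. *)
Definition right_cross x : talg2 F A -> talg2 F A :=
  linext (fun k : {fmonom A} * {fmonom A} =>
    q ^+ size k.2 *: tens (<< k.1 >> * gen F (wdeg g k.2 x)) << k.2 >>).

Definition right_append x : talg2 F A -> talg2 F A :=
  linext (fun k : {fmonom A} * {fmonom A} => tens << k.1 >> (<< k.2 >> * gen F x)).

Lemma right_cross_lin x : linear (right_cross x). Proof. exact: linearP. Qed.
Lemma right_append_lin x : linear (right_append x). Proof. exact: linearP. Qed.

Lemma right_append_tens x a b : right_append x (tens a b) = tens a (b * gen F x).
Proof.
apply: (tens_lin2_eq (b := fun a b => tens a (b * gen F x))) => [||f c u v|s t].
- exact: right_append_lin.
- by move=> f c u v; rewrite mulr_linl tens_linr.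
- by rewrite tens_linl.
by rewrite [in LHS]tens_word; apply: linextU.
Qed.

Lemma right_cross_tens x a t : right_cross x (tens a (word F t)) =
  q ^+ size t *: tens (a * gen F (wdeg g (FMonom t) x)) (word F t).
Proof.
have l1 : linear (fun a => right_cross x (tens a (word F t))).
  by move=> c u v; rewrite tens_linl right_cross_lin.
have l2 : linear (fun a =>
    q ^+ size t *: tens (a * gen F (wdeg g (FMonom t) x)) (word F t)).
  by move=> c u v; rewrite mulr_linl tens_linl scalerDr !scalerA mulrC.
by apply: (word_lin_eq l1 l2) => s; rewrite [in LHS]tens_word; apply: linextU.
Qed.

End Twist.

(** * Braided ideals *)

Section RightMultiplication.
Variables (F : fieldType) (A : finZmodType) (g : {perm A}) (q : F).
Hypothesis gD : {morph g : x y / x + y}.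
Implicit Types (f h a b : talg F A) (s t : seq A) (x y z : A).

Local Notation K := (twist g q).

Definition right_mul x (d : talg2 F A) := right_append x d + right_cross g q x d.

Lemma right_mul_lin x : linear (right_mul x).
Proof.
move=> a u v; rewrite /right_mul right_append_lin right_cross_lin.
by rewrite scalerDr addrACA.
Qed.

Lemma right_mul_word x s t : right_mul x (tens (word F s) (word F t)) =
  tens (word F s) (word F (rcons t x)) +
  q ^+ size t *: tens (word F (rcons s (wdeg g (FMonom t) x))) (word F t).
Proof.
by rewrite /right_mul right_append_tens right_cross_tens !wordM !cats1.
Qed.

Lemma right_mul_left x y (d : talg2 F A) :
  right_mul x (left_letter y d) = left_letter y (right_mul x d).
Proof.
have l1 : linear (fun d : talg2 F A => right_mul x (left_letter y d)).
  by move=> a u v; rewrite left_letter_lin right_mul_lin.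
have l2 : linear (fun d : talg2 F A => left_letter y (right_mul x d)).
  by move=> a u v; rewrite right_mul_lin left_letter_lin.
apply: (tens_lin_eq l1 l2) => s t; rewrite left_letter_tens -word_cons.
apply: (etrans (right_mul_word _ _ _)); rewrite right_mul_word.
rewrite (linearD_fun _ _ (left_letter_lin y)) (linearZ_fun _ _ (left_letter_lin y)).
apply: (f_equal2 +%R); first by rewrite left_letter_tens -word_cons.
by rewrite left_letter_tens -word_cons.
Qed.

Lemma right_mul_right x y (d : talg2 F A) :
  right_mul x (right_letter g q y d) = right_letter g q y (right_mul x d).
Proof.
have l1 : linear (fun d : talg2 F A => right_mul x (right_letter g q y d)).
  by move=> a u v; rewrite right_letter_lin right_mul_lin.
have l2 : linear (fun d : talg2 F A => right_letter g q y (right_mul x d)).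
  by move=> a u v; rewrite right_mul_lin right_letter_lin.
apply: (tens_lin_eq l1 l2) => s t; rewrite right_letter_tens twist_word -word_cons tensZl.
rewrite (linearZ_fun _ _ (right_mul_lin x)) [in RHS]right_mul_word.
apply: (etrans (f_equal ( *:%R _) (right_mul_word _ _ _))).
rewrite (linearD_fun _ _ (right_letter_lin g q y)).
rewrite (linearZ_fun _ _ (right_letter_lin g q y)) scalerDr.
apply: (f_equal2 +%R).
  by rewrite right_letter_tens twist_word -word_cons tensZl.
rewrite right_letter_tens twist_word -word_cons tensZl !scalerA map_rcons.
rewrite size_rcons wdeg_cons permM -!exprD.
by rewrite (_ : (size s + size (y :: t) = size t + (size s).+1)%N) //=; lia.
Qed.

Lemma comul_genM f x : comul g q (f * gen F x) = right_mul x (comul g q f).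
Proof.
have l1 : linear (fun f => comul g q (f * gen F x)).
  by move=> a u v; rewrite mulr_linl comul_lin.
have l2 : linear (fun f => right_mul x (comul g q f)).
  by move=> a u v; rewrite comul_lin right_mul_lin.
apply: (word_lin_eq l1 l2) => s; rewrite wordM cats1; elim: s => [|y s IH].
  have e : comul g q (word F [::]) = tens (word F [::]) (word F [::]).
    by rewrite comul_word; apply: (f_equal2 (@tens F A)); apply: word1.
  rewrite comul_cons e.
  apply: (etrans (f_equal2 +%R (left_letter_tens _ _ _) (right_letter_tens _ _ _ _ _))).
  apply: etrans (esym (right_mul_word _ _ _)).
  apply: (etrans (addrC _ _)); apply: (f_equal2 +%R).
    exact: (f_equal2 (@tens F A) (twist1 _ _ _) (esym (word_cons _ _ _))).
  rewrite expr0 scale1r perm1.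
  exact: (f_equal (fun a => tens a _) (esym (word_cons _ _ _))).
rewrite rcons_cons comul_cons IH comul_cons (linearD_fun _ _ (right_mul_lin x)).
apply: (f_equal2 +%R); first exact: esym (right_mul_left _ _ _).
exact: esym (right_mul_right _ _ _).
Qed.

End RightMultiplication.

Section BraidedIdeals.
Variables (F : fieldType) (A : finZmodType) (g : {perm A}) (q : F).
Hypothesis gD : {morph g : x y / x + y}.
Implicit Types (f h a b : talg F A) (s t : seq A) (x y z : A).
Implicit Types (I X P : set (talg F A)).

Local Notation K := (twist g q).

Lemma two_sided_gen I : is_subspace I ->
  (forall x f, I f -> I (gen F x * f) /\ I (f * gen F x)) -> two_sided_ideal I.
Proof.
move=> II Ix; split=> // f h If; split.
  have l : linear (fun h => h * f) by move=> a u v; apply: mulr_linl.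
  apply: (word_ind (S := [set h | I (h * f)])) => [|s] /=.
    split=> [|a u v /= Iu Iv]; first by rewrite /= mul0r; apply: subspace0.
    rewrite mulr_linl; exact: (II.2 a _ _ Iu Iv).
  elim: s => [|x s IH]; first by rewrite -word1 mul1r.
  by rewrite word_cons -mulrA; apply: (Ix x _ IH).1.
apply: (word_ind (S := [set h | I (f * h)])) => [|s] /=.
  split=> [|a u v /= Iu Iv]; first by rewrite /= mulr0; apply: subspace0.
  rewrite mulr_linr; exact: (II.2 a _ _ Iu Iv).
elim: s f If => [|x s IH] f If; first by rewrite -word1 mulr1.
by rewrite word_cons mulrA; apply: IH; apply: (Ix x _ If).2.
Qed.

Lemma braid_word s f : braid g q (tens (word F s) f) =
  tens (foldr (fun x => K x) f s) (word F s).
Proof.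
have lb : linear (braid g q : talg2 F A -> talg2 F A) by exact: linearP.
have l1 : linear (fun f => braid g q (tens (word F s) f)).
  by move=> a u v; rewrite tens_linr lb.
have lf : linear (fun f => foldr (fun x => K x) f s).
  by move=> a u v; elim: s {l1} => //= x s ->; rewrite twist_lin.
have l2 : linear (fun f => tens (foldr (fun x => K x) f s) (word F s)).
  by move=> a u v; rewrite lf tens_linl.
have fE v : foldr (fun x => K x) (word F v) s =
    q ^+ (size s * size v) *: word F (map (wdeg g (FMonom s)) v).
  elim: s {l1 lf l2} => [|x s IH] /=.
    by rewrite scale1r (eq_map (g := id)) ?map_id // => y; apply: perm1.
  rewrite IH (linearZ_fun _ _ (twist_lin g q x)) twist_word scalerA size_map -map_comp.
  rewrite -exprD addnC -mulSn (eq_map (g := wdeg g (FMonom (x :: s)))).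
    reflexivity.
  by move=> y; rewrite wdeg_cons permM.
apply: (word_lin_eq l1 l2) => v; rewrite fE tensZl [in RHS]tens_word tens_word.
exact: linextU.
Qed.

(** Read off the coefficient of the letter [x] in the right factor of the
    braiding of [x (x) f]. *)
Lemma braided_twist I x f : braided_ideal g q I -> I f -> I (K x f).
Proof.
move=> [[II _] Ib] If; have := Ib (word F [:: x]) f If; rewrite braid_word /=.
have r0 : is_subspace [set d : talg2 F A | I (right_coef (FMonom [:: x]) d)].
  split=> [|a u v /= Iu Iv]; first by rewrite /= linear0; apply: subspace0.
  by rewrite right_coef_lin; apply: II.2.
have sub : tens_space I setT `<=` [set d | I (right_coef (FMonom [:: x]) d)].
  apply: lin_span_min => // _ [a Ia [b _ <-]] /=.
  by rewrite right_coef_tens; apply: (subspaceZ _ II).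
move=> /sub /=; rewrite right_coef_tens word_coef eqxx scale1r.
by [].
Qed.

(** The operator of a word is the composition of the operators of its
    letters. *)
Lemma twist_braided I : two_sided_ideal I ->
  (forall x f, I f -> I (K x f)) -> braided_ideal g q I.
Proof.
move=> I2 Ix; split=> // t f If.
have lb : linear (fun t : talg F A => braid g q (tens t f)).
  by move=> a u v; rewrite tens_linl; apply: linearP.
apply: (word_ind (S := [set t : talg F A |
  tens_space I setT (braid g q (tens t f))])) => [|s] /=.
  split=> [|a u v /= Iu Iv].
    by rewrite /= (linear_fun0 lb); apply: subspace0; apply: tens_space_subspace.
  by rewrite lb; apply: (tens_space_subspace I setT).2.
rewrite braid_word; apply: tens_space_tens => //.
by elim: s => //= x s; apply: Ix.
Qed.

(** Via the operators [twist x] the defining condition becomes one that is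
    visibly closed under intersections. *)
Lemma braided_gen X : braided_ideal g q (braided_ideal_gen g q X).
Proof.
apply: twist_braided; last first.
  move=> x f If J JX; apply: (braided_twist x JX.1); exact: (If J JX).
split.
  split=> [J [[[JJ _] _] _]|a u v Iu Iv J JX]; first exact: subspace0.
  by case: (JX) => -[[JJ _] _] _; apply: JJ.2; [exact: Iu | exact: Iv].
move=> f h If; split=> J JX; case: (JX) => -[[_ J2] _] _.
  by apply: (J2 _ _ (If J JX)).1.
by apply: (J2 _ _ (If J JX)).2.
Qed.

Lemma sub_braided_gen X : X `<=` braided_ideal_gen g q X.
Proof. exact: sub_smallest. Qed.

Lemma braided_gen_min X P : is_subspace P -> X `<=` P ->
  (forall x f, P f -> [/\ P (gen F x * f), P (f * gen F x) & P (K x f)]) ->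
  braided_ideal_gen g q X `<=` P.
Proof.
move=> PP XP Px; apply: smallest_sub => //; apply: twist_braided.
  by apply: two_sided_gen => // x f /(Px x)[].
by move=> x f /(Px x)[].
Qed.

End BraidedIdeals.

(** * Coideals generated by primitive elements *)

Section InnGrading.
Variables (F : fieldType) (A : finZmodType) (g : {perm A}) (q : F).
Hypothesis gD : {morph g : x y / x + y}.
Implicit Types (f h a b : talg F A) (s t : seq A) (x y z : A) (p : {perm A}).
Implicit Types (I X P : set (talg F A)).

Local Notation K := (twist g q).

Definition inn_comp p : talg F A -> talg F A :=
  wcomp (fun w => wdeg g w == p).

Lemma inn_comp_lin p : linear (inn_comp p). Proof. exact: linearP. Qed.

Lemma inn_comp_word p s : inn_comp p (word F s) =
  if wdeg g (FMonom s) == p then word F s else 0.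
Proof. exact: wcomp_word. Qed.

Lemma inn_comp_genM p x f :
  inn_comp p (gen F x * f) = gen F x * inn_comp (p * (phi g x)^-1)%g f.
Proof.
have l1 : linear (fun f => inn_comp p (gen F x * f)).
  by move=> a u v; rewrite mulr_linr inn_comp_lin.
have l2 : linear (fun f => gen F x * inn_comp (p * (phi g x)^-1)%g f).
  by move=> a u v; rewrite inn_comp_lin mulr_linr.
apply: (word_lin_eq l1 l2) => s; rewrite -word_cons !inn_comp_word wdeg_cons.
rewrite -(inj_eq (mulIg (phi g x)^-1%g)) mulgK.
by case: (_ == _); rewrite ?mulr0 // -word_cons.
Qed.

Lemma inn_compM_gen p x f :
  inn_comp p (f * gen F x) = inn_comp ((phi g x)^-1 * p)%g f * gen F x.
Proof.
have l1 : linear (fun f => inn_comp p (f * gen F x)).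
  by move=> a u v; rewrite mulr_linl inn_comp_lin.
have l2 : linear (fun f => inn_comp ((phi g x)^-1 * p)%g f * gen F x).
  by move=> a u v; rewrite inn_comp_lin mulr_linl.
apply: (word_lin_eq l1 l2) => s; rewrite wordM cats1 !inn_comp_word wdeg_rcons.
rewrite -(inj_eq (mulgI (phi g x)^-1%g)) mulKg.
by case: (_ == _); rewrite ?mul0r // wordM cats1.
Qed.

Lemma inn_comp_twist p x f :
  inn_comp p (K x f) = K x (inn_comp (phi g x * p * (phi g x)^-1)%g f).
Proof.
have l1 : linear (fun f => inn_comp p (K x f)).
  by move=> a u v; rewrite twist_lin inn_comp_lin.
have l2 : linear (fun f => K x (inn_comp (phi g x * p * (phi g x)^-1)%g f)).
  by move=> a u v; rewrite inn_comp_lin twist_lin.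
apply: (word_lin_eq l1 l2) => s.
rewrite twist_word (linearZ_fun _ _ (inn_comp_lin p)) !inn_comp_word.
rewrite -(inj_eq (mulgI (phi g x))) -wdeg_map // -(inj_eq (mulIg (phi g x)^-1%g)) mulgK.
case: (_ == _); rewrite ?twist_word // scaler0.
by rewrite (linear_fun0 (twist_lin g q x)).
Qed.

(** Multiplications by letters and the operators [twist x] permute the
    components. *)
Lemma braided_gen_inn X :
  (forall p f, X f -> braided_ideal_gen g q X (inn_comp p f)) ->
  forall p f, braided_ideal_gen g q X f -> braided_ideal_gen g q X (inn_comp p f).
Proof.
move=> XI p f If; pose I := braided_ideal_gen g q X.
have bI : braided_ideal g q I by apply: braided_gen.
have [[II I2] _] := bI.
pose P : set (talg F A) := [set f | I f /\ forall p, I (inn_comp p f)].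
suff /(_ _ If)[_ ] : I `<=` P by apply.
apply: braided_gen_min => [|h Xh|x h [Ih Ph]].
- split=> [|a u v [Iu Pu] [Iv Pv]]; split=> [|p'].
  + exact: subspace0.
  + by rewrite (linear_fun0 (inn_comp_lin p')); apply: subspace0.
  + exact: II.2.
  by rewrite inn_comp_lin; apply: II.2.
- by split=> [|p']; [apply: sub_braided_gen | apply: XI].
split; split=> [|p']; rewrite ?inn_comp_genM ?inn_compM_gen ?inn_comp_twist.
- exact: (I2 _ _ Ih).1.
- exact: (I2 _ _ (Ph _)).1.
- exact: (I2 _ _ Ih).2.
- exact: (I2 _ _ (Ph _)).2.
- exact: (braided_twist x bI Ih).
exact: (braided_twist x bI (Ph _)).
Qed.

Definition degree_scale : talg F A -> talg F A :=
  linext (fun w : {fmonom A} => q ^+ size w *: << w >>).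

Lemma degree_scale_lin : linear degree_scale. Proof. exact: linearP. Qed.

Lemma degree_scale_word s : degree_scale (word F s) = q ^+ size s *: word F s.
Proof. exact: linextU. Qed.

(** On words of degree [p] the letter [x] becomes [p x], whatever the word: this is
    where homogeneity enters. *)
Lemma right_cross_sum x a b : right_cross g q x (tens a b) =
  \sum_(p : {perm A}) tens (a * gen F (p x)) (degree_scale (inn_comp p b)).
Proof.
have l1 : linear (fun b => right_cross g q x (tens a b)).
  by move=> c u v; rewrite tens_linr right_cross_lin.
have l2 : linear (fun b =>
    \sum_(p : {perm A}) tens (a * gen F (p x)) (degree_scale (inn_comp p b))).
  move=> c u v; rewrite scaler_sumr -big_split; apply: eq_bigr => p _.
  by rewrite inn_comp_lin degree_scale_lin tens_linr.
apply: (word_lin_eq l1 l2) => s.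
rewrite right_cross_tens (bigD1 (wdeg g (FMonom s))) //= big1 => [|p sp].
  rewrite addr0 inn_comp_word eqxx degree_scale_word.
  by rewrite (linearZ_fun _ _ (tens_is_linear _)).
rewrite inn_comp_word eq_sym (negPf sp) (linear_fun0 degree_scale_lin).
exact: (linear_fun0 (tens_is_linear _)).
Qed.

(** The elements of the ideal with counit zero and coproduct in the tensor
    kernel contain [X] and are stable under letters on both sides and [twist x]. *)
Lemma braided_gen_coideal X :
  (forall f, X f -> counit f = 0 /\ tens_ker (braided_ideal_gen g q X) (comul g q f)) ->
  (forall p f, braided_ideal_gen g q X f ->
    braided_ideal_gen g q X (degree_scale (inn_comp p f))) ->
  coideal g q (braided_ideal_gen g q X).
Proof.
pose I := braided_ideal_gen g q X; rewrite -/I => Xc Isc.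
have bI : braided_ideal g q I by apply: braided_gen.
have [[II I2] _] := bI; have KK := tens_ker_subspace I; split=> //.
pose P : set (talg F A) :=
  [set f | I f /\ counit f = 0 /\ tens_ker I (comul g q f)].
suff IP : I `<=` P by move=> f /IP[].
have ker_lin (L : talg2 F A -> talg2 F A) : linear L ->
    (forall a b, I a -> tens_ker I (L (tens a b))) ->
    (forall a b, I b -> tens_ker I (L (tens a b))) ->
    forall d, tens_ker I d -> tens_ker I (L d).
  move=> lL La Lb; apply: (tens_ker_min (S := [set d | tens_ker I (L d)])) => //.
  split=> [|a u v /= Iu Iv]; first by rewrite /= (linear_fun0 lL); apply: KK.1.
  by rewrite lL; apply: KK.2.
apply: braided_gen_min => [|f Xf|x f [If [c0 Df]]].
- split=> [|a u v [Iu [cu Du]] [Iv [cv Dv]]].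
    split; first exact: subspace0.
    rewrite (linear_fun0 (comul_lin g q)); split; last exact: KK.1.
    by rewrite /counit mcoeff0.
  split; first exact: II.2.
  by rewrite counit_lin cu cv mulr0 addr0 comul_lin; split=> //; apply: KK.2.
- by split; [apply: sub_braided_gen | apply: Xc].
split; split.
- exact: (I2 _ _ If).1.
- rewrite counit_genM comulM_gen; split=> //; apply: (subspaceD KK).
    apply: (ker_lin _ (left_letter_lin x)) Df => a b Iab; rewrite left_letter_tens.
      by apply: tens_kerl; apply: (I2 _ _ Iab).1.
    exact: tens_kerr.
  apply: (ker_lin _ (right_letter_lin g q x)) Df => a b Iab; rewrite right_letter_tens.
    by apply: tens_kerl; apply: (braided_twist x bI Iab).
  by apply: tens_kerr; apply: (I2 _ _ Iab).1.
- exact: (I2 _ _ If).2.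
- rewrite counitM_gen comul_genM // /right_mul; split=> //; apply: (subspaceD KK).
    apply: (ker_lin _ (right_append_lin x)) Df => a b Iab; rewrite right_append_tens.
      exact: tens_kerl.
    by apply: tens_kerr; apply: (I2 _ _ Iab).2.
  apply: (ker_lin _ (right_cross_lin g q x)) Df => a b Iab; rewrite right_cross_sum;
    apply: (subspace_sum _ KK) => p _.
    by apply: tens_kerl; apply: (I2 _ _ Iab).2.
  by apply: tens_kerr; apply: Isc.
- exact: (braided_twist x bI If).
rewrite counit_twist comul_twist //; split=> //.
apply: (ker_lin _ (twist2_lin g q x)) Df => a b Iab; rewrite twist2_tens.
  by apply: tens_kerl; apply: (braided_twist x bI Iab).
by apply: tens_kerr; apply: (braided_twist x bI Iab).
Qed.

End InnGrading.

Section Parity.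
Variables (F : fieldType) (A : finZmodType) (g : {perm A}).
Hypothesis gD : {morph g : x y / x + y}.
Implicit Types (f : talg F A) (s t : seq A) (p : {perm A}).
Implicit Types (I : set (talg F A)).

Local Notation parity := (@degree_scale F A (-1)).

Lemma wdeg_diff s y z :
  wdeg g (FMonom s) y - wdeg g (FMonom s) z = (g ^+ size s)%g (y - z).
Proof.
elim: s => [|x s IH]; first by rewrite /wdeg /= expg0 !perm1.
rewrite !wdeg_cons !permM !phiE expgSr permM -IH /affop opprD addrACA subrr add0r.
set u := wdeg _ _ y; set v := wdeg _ _ z.
have gN := additive_funN gD.
by rewrite -gN -gD opprB addrA subrK.
Qed.

(** If [g] has odd order [N], then [N] applications of [twist 0], whose underlying
    map is [g], give the parity operator.  If the order is even, words of
    the same degree have lengths congruent modulo this order by [wdeg_diff], so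
    the parity operator is a sign on each component. *)
Lemma parity_inn_comp I p f : braided_ideal g (-1) I -> (forall p f, I f -> I (inn_comp g p f)) ->
  I f -> I (parity (inn_comp g p f)).
Proof.
move=> bI Ip If; have [[II _] _] := bI; have Ipf := Ip p f If.
have g0 := additive_fun0 gD.
have [og|og] := boolP (odd #[g]%g).
  move: (inn_comp g p f) Ipf => h Ih.
  have -> : parity h = iter #[g]%g (twist g (-1) 0) h.
    have l2 : linear (iter #[g]%g (twist g (-1 : F) 0)).
      by apply: iter_linear; apply: twist_lin.
    apply: (word_lin_eq (@degree_scale_lin F A (-1)) l2) => s; rewrite degree_scale_word.
    have -> n : iter n (twist g (-1) 0) (word F s) =
        (-1) ^+ (n * size s) *: word F (map (g ^+ n)%g s).
      elim: n => [|n /= ->].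
        by rewrite mul0n scale1r (eq_map (g := id)) ?map_id // => y; rewrite expg0 perm1.
      rewrite (linearZ_fun _ _ (twist_lin g _ _)) twist_word scalerA -exprD size_map.
      rewrite mulSnr -map_comp (eq_map (g := (g ^+ n.+1)%g)) // => y.
      by rewrite /= phiE /affop subr0 add0r expgSr permM.
    rewrite expg_order (eq_map (g := id)) ?map_id; last by move=> y; rewrite perm1.
    by rewrite -signr_odd oddM og signr_odd.
  by elim: #[g]%g => //= n; apply: braided_twist.
have par s s' : wdeg g (FMonom s) = wdeg g (FMonom s') -> odd (size s) = odd (size s').
  move=> ss'; have : (g ^+ size s = g ^+ size s')%g.
    by apply/permP => y; rewrite -[y]subr0 -!wdeg_diff ss'.
  move/eqP; rewrite eq_expg_mod_order => /eqP /(congr1 odd).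
  by rewrite !odd_mod //; apply: negbTE.
have [e pe] : exists e : F, forall s, wdeg g (FMonom s) = p -> (-1) ^+ size s = e.
  have [[s0 s0p]|no] := pselect (exists s, wdeg g (FMonom s) = p).
    exists ((-1) ^+ size s0) => s sp.
    by rewrite -[LHS]signr_odd -[RHS]signr_odd (par s s0) // sp.
  by exists 1 => s sp; case: no; exists s.
have l1 : linear (fun f => parity (inn_comp g p f)).
  by move=> a u v; rewrite inn_comp_lin degree_scale_lin.
have l2 : linear (fun f => e *: inn_comp g p f).
  by move=> a u v; rewrite inn_comp_lin scalerDr !scalerA mulrC.
rewrite (word_lin_eq l1 l2) => [|s]; first exact: subspaceZ.
rewrite inn_comp_word; case: eqP => [sp|_].
  by rewrite degree_scale_word (pe _ sp).
by rewrite (linear_fun0 (@degree_scale_lin F A (-1))) scaler0.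
Qed.

Lemma wdeg_Inn w : wdeg g w \in Inn g.
Proof.
rewrite -[w]fmK; elim: (w : seq A) => [|x s IH]; first by rewrite /wdeg /= group1.
by rewrite wdeg_cons groupM // mem_gen //; apply/imsetP; exists x.
Qed.

Theorem adjoin_primitive (Q : set (talg F A)) r :
  kerQ2 g (-1) `<=` Q -> Inn_homog_space g Q -> coideal g (-1) Q ->
  Inn_homog_elt g r -> counit r = 0 -> primitive_mod g (-1) (J2 g (-1)) r ->
  let I := braided_ideal_gen g (-1) (add_set Q [set a *: r | a in [set: F]]) in
  Inn_homog_space g I /\ coideal g (-1) I.
Proof.
move=> kQ [QQ Qh] [_ Qc] [h0 hI rh] cr pr; set X := add_set _ _ => I.
have rr : is_subspace [set a *: r | a in [set: F]].
  split=> [|a _ _ [b _ <-] [c _ <-]]; first by exists 0; rewrite ?scale0r.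
  by exists (a * b + c); rewrite // scalerDl scalerA.
have bI : braided_ideal g (-1) I by apply: braided_gen.
have [[II I2] _] := bI.
have QI : Q `<=` I.
  by move=> f Qf; apply: sub_braided_gen; apply: sub_add_setl.
have rI : I r.
  by apply: sub_braided_gen; apply: sub_add_setr => //; exists 1; rewrite ?scale1r.
have JI : J2 g (-1) `<=` I.
  by apply: smallest_sub; [exact: bI.1 | move=> k /kQ /QI].
have XI p f : X f -> I (inn_comp g p f).
  have l : linear (inn_comp g p : talg F A -> talg F A) by apply: inn_comp_lin.
  have S : is_subspace [set f | I (inn_comp g p f)].
    split=> [|a u v /= Iu Iv]; first by rewrite /= (linear_fun0 l); apply: subspace0.
    by rewrite l; apply: II.2.
  apply: (add_set_min S) => [u Qu|_ [a _ <-]] /=.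
    have [pI|pI] := boolP (p \in Inn g); first by apply: QI; apply: Qh.
    rewrite (_ : inn_comp g p u = 0); first exact: subspace0.
    by apply: wcomp_eq0 => w _; apply: contraNN pI => /eqP <-; apply: wdeg_Inn.
  rewrite (linearZ_fun _ _ l); apply: (subspaceZ _ II).
  have [hp|hp] := eqVneq h0 p.
    rewrite (_ : inn_comp g p r = r) //.
    by apply: wcomp_id => w /rh ->; rewrite hp.
  rewrite (_ : inn_comp g p r = 0); first exact: subspace0.
  by apply: wcomp_eq0 => w /rh ->.
have Ip := braided_gen_inn gD XI.
split; first by split=> // p _ f; apply: Ip.
apply: (braided_gen_coideal gD) => [f|p f If]; last first.
  exact: (@parity_inn_comp I p f bI Ip If).
have KK := tens_ker_subspace I.
have S : is_subspace [set f | counit f = 0 /\ tens_ker I (comul g (-1) f)].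
  split=> [|a u v [cu Du] [cv Dv]].
    by split; [rewrite /counit mcoeff0 | rewrite (linear_fun0 (comul_lin g _)); exact: KK.1].
  split; first by rewrite counit_lin cu cv mulr0 addr0.
  by rewrite comul_lin; apply: KK.2.
apply: (add_set_min S) => [u /Qc[cu Du]|_ [a _ <-]].
  by split=> //; apply: (tens_kerS QI).
apply: (subspaceZ a S); split=> //.
have -> : comul g (-1) r =
    (comul g (-1) r - (tens r 1 + tens 1 r)) + (tens r 1 + tens 1 r) by rewrite subrK.
apply: (subspaceD KK); first exact: (tens_kerS JI).
by apply: (subspaceD KK); [apply: tens_kerl | apply: tens_kerr].
Qed.

End Parity.

(** * Certificates of primitivity *)

Section FreeLetters.
Variables (F : fieldType) (A : finZmodType) (g : {perm A}).
Hypothesis gD : {morph g : x y / x + y}.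
Variables (M : zmodType) (G : M -> M) (e : M -> A) (base : A).
Hypothesis eD : {morph e : u v / u + v}.
Hypothesis eG : forall u, g (e u) = e (G u).
Implicit Types (a b c : M) (u v w l r : seq M).

(** A code [u] in [M] stands for the letter [base + e u]; the operation on codes
    lifts the one of the rack. *)
Definition code_op a b := a + G (b - a).

Definition letter a : A := base + e a.

Definition cword u : talg F A := word F (map letter u).

Lemma letter_op a b : letter (code_op a b) = affop g (letter a) (letter b).
Proof.
have eN := additive_funN eD.
rewrite /letter /affop /code_op eD -eG eD eN addrA; congr (_ + g _).
by rewrite opprD addrACA subrr add0r.
Qed.

(** A sign ([true] for minus) and a pair of words. *)
Definition term := (bool * (seq M * seq M))%type.

Definition term_eval (t : term) : talg2 F A :=
  (-1) ^+ t.1 *: tens (cword t.2.1) (cword t.2.2).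

Definition terms_eval (ts : seq term) : talg2 F A := \sum_(t <- ts) term_eval t.

(** The recursion of [comul_cons] on codes: each letter goes to the left factor,
    or to the right one, acting then on the left word that follows it. *)
Fixpoint word_comul w : seq term :=
  if w is x :: w' then
    [seq (t.1, (x :: t.2.1, t.2.2)) | t <- word_comul w'] ++
    [seq (t.1 (+) odd (size t.2.1), (map (code_op x) t.2.1, x :: t.2.2))
    | t <- word_comul w']
  else [:: (false, ([::], [::]))].

Lemma word_comulE w : comul g (-1) (cword w) = terms_eval (word_comul w).
Proof.
elim: w => [|x w IH].
  rewrite /terms_eval big_seq1 /term_eval scale1r /cword /= comul_word.
  by apply: (f_equal2 (@tens F A)); apply: word1.
rewrite /cword map_cons comul_cons -/(cword w) IH /terms_eval big_cat !big_map.
apply: (f_equal2 +%R).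
  rewrite (linear_sum_fun _ _ _ (left_letter_lin (letter x))); apply: eq_bigr => t _.
  rewrite (linearZ_fun _ _ (left_letter_lin (letter x))) left_letter_tens.
  by rewrite /cword -word_cons.
rewrite (linear_sum_fun _ _ _ (right_letter_lin g (-1) (letter x))).
apply: eq_bigr => -[s [l r]] _ /=; rewrite /term_eval /=.
have El : map (phi g (letter x)) (map letter l) = map letter (map (code_op x) l).
  by rewrite -!map_comp; apply: eq_map => y; rewrite /= letter_op phiE.
rewrite (linearZ_fun _ _ (right_letter_lin g (-1) (letter x))) right_letter_tens.
rewrite /cword twist_word -word_cons tensZl scalerA El size_map.
have -> : (-1) ^+ s * (-1) ^+ size l = (-1) ^+ (s (+) odd (size l)) :> F.
  by rewrite signr_addb signr_odd.
reflexivity.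
Qed.

Variable n : nat.

(** Elements of [J2]: the square of a letter, the sum over [n] steps of the orbit
    of a pair, and, for [n = 3], the braid relation. *)
Inductive relator := Sq of M | Cyc of M & M | Brd of M & M.

Definition relator_words (p : relator) : seq (bool * seq M) :=
  match p with
  | Sq a => [:: (false, [:: a; a])]
  | Cyc a b => [seq (false, [:: k.1; k.2])
               | k <- traject (fun k => (code_op k.1 k.2, k.1)) (a, b) n]
  | Brd a b => if n == 3
               then [:: (false, [:: a; b; a]); (true, [:: b; a; b])] else [::]
  end.

Definition relator_eval p : talg F A :=
  \sum_(t <- relator_words p) (-1) ^+ t.1 *: cword t.2.

Hypothesis period : forall a b,
  iter n (next_pair g) (letter a, letter b) = (letter a, letter b).

Local Notation J := (@J2 F A g (-1)).

Lemma J2_ideal : two_sided_ideal J.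
Proof.
split.
  split=> [I [[II _] _]|a u v Ju Jv I IK]; first exact: subspace0.
  by case: (IK) => -[II _] _; apply: II.2; [apply: Ju | apply: Jv].
move=> f h Jf; split=> I IK; case: (IK) => -[_ I2] _; first exact: (I2 _ _ (Jf I IK)).1.
exact: (I2 _ _ (Jf I IK)).2.
Qed.

Lemma rel2_J2 f : nichols_rel2 g (-1) f -> J f.
Proof.
move=> /(nichols_rel2P _ gD)[hf ff] I [_]; apply; split=> //.
by rewrite qsym2E.
Qed.

Lemma square_J2 (x : A) : J (word F [:: x; x]).
Proof.
apply: rel2_J2; apply/(nichols_rel2P _ gD); split; first exact: homog_word.
rewrite (@sigma_word F A g (-1) 0 [::]) // /affop subrr.
have -> : g 0 = 0 by apply: additive_fun0.
by rewrite addr0 scaleN1r subrr.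
Qed.

Lemma cycle_J2 m (p : A * A) : iter m (next_pair g) p = p ->
  J (\sum_(k <- traject (next_pair g) p m) pair_word F k).
Proof.
move=> pm; apply: rel2_J2; have := @cycle_rel2 F A g (-1) gD p m pm.
rewrite opprK expr1n => /(_ erefl).
have -> : traject (next_pair g) p m = [seq iter i (next_pair g) p | i <- index_iota 0 m].
  apply: (@eq_from_nth _ p) => [|i]; first by rewrite size_map size_iota size_traject subn0.
  rewrite size_traject => im; rewrite nth_traject // (nth_map 0%N) ?size_iota ?subn0 //.
  by rewrite nth_iota ?subn0.
rewrite big_map big_mkord.
by under eq_bigr => i _ do rewrite expr1n scale1r.
Qed.

(** With [c = x |> y] and the orbit sum [rho = xy + cx + yc], the difference is
    [rho x - y rho - c xx + yy c]. *)
Lemma braid_J2 (x y : A) : iter 3 (next_pair g) (x, y) = (x, y) ->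
  J (word F [:: x; y; x] - word F [:: y; x; y]).
Proof.
move=> xy3; have [JJ J2] := J2_ideal; set c := affop g x y.
have cy : affop g c x = y by case: xy3.
have : J (word F [:: x; y] + word F [:: c; x] + word F [:: y; c]).
  have := cycle_J2 xy3.
  have -> : traject (next_pair g) (x, y) 3 = [:: (x, y); (c, x); (y, c)].
    by rewrite /= /next_pair /= -/c cy.
  rewrite big_cons big_cons big_seq1 addrA; apply.
set rho := (_ + _ + _) => Jr.
have rx : rho * gen F x =
    word F [:: x; y; x] + word F [:: c; x; x] + word F [:: y; c; x].
  rewrite /rho 2!mulrDl.
  exact: (f_equal2 +%R (f_equal2 +%R (wordM _ _ _) (wordM _ _ _)) (wordM _ _ _)).
have yr : gen F y * rho =
    word F [:: y; x; y] + word F [:: y; c; x] + word F [:: y; y; c].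
  rewrite /rho 2!mulrDr.
  exact: (f_equal2 +%R (f_equal2 +%R (wordM _ _ _) (wordM _ _ _)) (wordM _ _ _)).
have J1 := (J2 _ (gen F x) Jr).2; rewrite rx in J1.
have J3 := (J2 _ (gen F y) Jr).1; rewrite yr in J3.
have J4 := (J2 _ (gen F c) (square_J2 x)).1; rewrite [gen F c * _]wordM in J4.
have J5 := (J2 _ (gen F c) (square_J2 y)).2; rewrite [_ * gen F c]wordM in J5.
have zE (V : zmodType) (a b d k l : V) : (a + b + k) - (d + k + l) - b + l = a - d.
  rewrite -[d + k + l]addrA [d + (k + l)]addrCA addrKA [a + b]addrC -[b + a - _]addrA.
  rewrite [b + _]addrC addrK.
  by rewrite opprD addrA subrK.
have := subspaceD JJ (subspaceB JJ (subspaceB JJ J1 J3) J4) J5.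
by rewrite zE.
Qed.


Lemma map_letter_traject m (k : M * M) :
  [seq (letter p.1, letter p.2) | p <- traject (fun p => (code_op p.1 p.2, p.1)) k m] =
  traject (next_pair g) (letter k.1, letter k.2) m.
Proof. by elim: m k => [//|m IH] k; rewrite /= IH /= letter_op. Qed.

Lemma relator_J2 p : J (relator_eval p).
Proof.
have [JJ _] := J2_ideal; case: p => [a|a b|a b]; rewrite /relator_eval /=.
- by rewrite big_seq1 scale1r; apply: square_J2.
- have := cycle_J2 (period a b).
  rewrite -(map_letter_traject n (a, b)) !big_map.
  by under [in X in _ -> X]eq_bigr => k _ do rewrite scale1r.
case: eqP => [n3|_]; last by rewrite big_nil; apply: subspace0.
have ab3 : iter 3 (next_pair g) (letter a, letter b) = (letter a, letter b).
  by have := period a b; rewrite n3.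
rewrite big_cons big_seq1 [nat_of_bool _]/= [nat_of_bool true]/= expr0 expr1 scale1r.
rewrite scaleN1r; exact: (braid_J2 ab3).
Qed.

(** The data [(s, u, p, v, r)] stand for [u * p * v (x) r] with a minus sign if
    [s] is [true]: a multiple of a relator in the coefficient of [r]. *)
Definition cert_line := (bool * seq M * relator * seq M * seq M)%type.

(** The signs are reversed, as the terms are to be cancelled against those of the
    coproduct. *)
Definition line_terms (c : cert_line) : seq term :=
  let: (s, u, p, v, r) := c in
  [seq (~~ s (+) t.1, (u ++ t.2 ++ v, r)) | t <- relator_words p].

Lemma line_terms_ker (c : cert_line) : tens_ker J (terms_eval (line_terms c)).
Proof.
have [JJ J2] := J2_ideal; case: c => [[[[s u] p] v] r].
have Jp := (J2 _ (cword v) (J2 _ (cword u) (relator_J2 p)).1).2.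
suff -> : terms_eval (line_terms (s, u, p, v, r)) =
    (-1) ^+ (~~ s) *: tens (cword u * relator_eval p * cword v) (cword r).
  by apply: (subspaceZ _ (tens_ker_subspace J)); apply: tens_kerl.
have l : linear (fun f => (-1) ^+ (~~ s) *: tens (cword u * f * cword v) (cword r)).
  move=> a f1 f2; rewrite (mulr_linr (cword u)) mulr_linl tens_linl.
  by rewrite scalerDr !scalerA mulrC.
rewrite (linear_sum_fun _ _ _ l) /terms_eval big_map; apply: eq_bigr => t _.
rewrite (linearZ_fun _ _ l) /term_eval /= signr_addb scalerA mulrC.
apply: (f_equal ( *:%R _)); apply: (f_equal (fun f => tens f _)).
rewrite /cword !map_cat -!wordM mulrA; reflexivity.
Qed.

Fixpoint braid_moves w : seq (seq M) :=
  if w is a :: w' then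
    (if w' is b :: c :: w'' then
      if (c == a) && (n == 3) then [:: [:: b, a, b & w'']] else [::]
     else [::]) ++ map (cons a) (braid_moves w')
  else [::].

Lemma braid_moves_J2 w w' : w' \in braid_moves w -> J (cword w - cword w').
Proof.
have [JJ J2] := J2_ideal; elim: w w' => [//|a w IH] w' /=; rewrite mem_cat => /orP[].
  case: w {IH} => [//|b [//|c w]]; case: ifP => // /andP[/eqP -> /eqP n3].
  rewrite inE => /eqP ->.
  have ab3 : iter 3 (next_pair g) (letter a, letter b) = (letter a, letter b).
    by have := period a b; rewrite n3.
  have := (J2 _ (cword w) (braid_J2 ab3)).2.
  by rewrite mulrBl /cword /= 2!wordM.
case/mapP => w1 /IH Jw ->; have := (J2 _ (gen F (letter a)) Jw).1.
by rewrite mulrBr /cword /= -2!word_cons.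
Qed.

(** Three rounds of moves reach all words needed below. *)
Definition braid_class w : seq (seq M) :=
  iter 3 (fun ws => undup (ws ++ flatten (map braid_moves ws))) [:: w].

Lemma braid_class_J2 w w' : w' \in braid_class w -> J (cword w - cword w').
Proof.
have [JJ _] := J2_ideal; rewrite /braid_class; elim: (3%N) w' => [|m IH] w'.
  by rewrite inE => /eqP ->; rewrite subrr; apply: subspace0.
rewrite iterS mem_undup mem_cat => /orP[/IH//|/flattenP[ws /mapP[w1 /IH J1 ->]]].
move=> /braid_moves_J2 J3; have := subspaceD JJ J1 J3.
by rewrite addrA subrK.
Qed.

Fixpoint has_square w : bool :=
  if w is a :: w' then
    (if w' is b :: _ then a == b else false) || has_square w'
  else false.

Lemma has_square_J2 w : has_square w -> J (cword w).
Proof.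
have [_ J2] := J2_ideal; elim: w => [//|a w IH] /= /orP[|/IH Jw]; last first.
  by have := (J2 _ (gen F (letter a)) Jw).1; rewrite /cword -word_cons.
case: w {IH} => [//|b w] /eqP <-.
have := (J2 _ (cword w) (square_J2 (letter a))).2.
by rewrite /cword wordM.
Qed.

(** Removes terms whose right word is equivalent to one with a square, and pairs
    of terms of opposite signs with the same left word and equivalent right
    words; [m] bounds the number of rounds. *)
Fixpoint cancels (m : nat) (ts : seq term) : bool :=
  match m, ts with
  | _, [::] => true
  | 0, _ => false
  | m'.+1, (s, (l, r)) :: ts' =>
    let rs := braid_class r in
    if has has_square rs then cancels m' ts' else
    let P (t : term) := [&& t.1 == ~~ s, t.2.1 == l & t.2.2 \in rs] in
    has P ts' && cancels m' (take (find P ts') ts' ++ drop (find P ts').+1 ts')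
  end.

Lemma cancels_ker m ts : cancels m ts -> tens_ker J (terms_eval ts).
Proof.
have [JJ J2] := J2_ideal; have KK := tens_ker_subspace J.
have nilK : tens_ker J (terms_eval [::]).
  by rewrite /terms_eval big_nil; apply: subspace0.
elim: m ts => [|m IH] [|[s [l r]] ts] //= H; rewrite /terms_eval big_cons /=.
case: ifP H => [/hasP[r' r'r sq] /IH ts0|_ /andP[]].
  apply: (subspaceD KK) => //; apply: (subspaceZ _ KK); apply: tens_kerr => /=.
  have := subspaceD JJ (braid_class_J2 r'r) (has_square_J2 sq).
  by rewrite subrK.
set P := fun t : term => _ => hP; have := hP; rewrite has_find => fP /IH.
set t := nth (s, (l, r)) ts (find P ts).
have : P t := nth_find _ hP.
case/and3P => /eqP t1 /eqP t21 t22.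
have tsE : ts = take (find P ts) ts ++ t :: drop (find P ts).+1 ts.
  by rewrite -drop_nth // cat_take_drop.
have sE : \sum_(t0 <- ts) term_eval t0 = \sum_(t0 <- take (find P ts) ts) term_eval t0 +
    (term_eval t + \sum_(t0 <- drop (find P ts).+1 ts) term_eval t0).
  by rewrite {1}tsE big_cat big_cons.
rewrite sE /terms_eval big_cat => K0.
have zE (V : zmodType) (a b c d : V) : a + (b + (d + c)) = (b + c) + (a + d).
  by rewrite [d + c]addrC [b + (c + d)]addrA addrCA.
rewrite zE; apply: (subspaceD KK K0).
rewrite /term_eval t1 t21 /=.
have sN (b : bool) : (-1) ^+ (~~ b) = - ((-1) ^+ b) :> F.
  by case: b; rewrite ?expr0 ?expr1 ?opprK.
rewrite sN scaleNr -scalerBr; apply: (subspaceZ _ KK).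
have l1 := tens_is_linear (cword l); rewrite -(linearB_fun _ _ l1).
by apply: tens_kerr; apply: braid_class_J2.
Qed.

Definition primitivity_terms (ws : seq (seq M)) (cert : seq cert_line) : seq term :=
  flatten [seq word_comul w ++ [:: (true, (w, [::])); (true, ([::], w))] | w <- ws] ++
  flatten (map line_terms cert).

Theorem primitive_certificate ws cert :
  (let ts := primitivity_terms ws cert in cancels (size ts) ts) ->
  primitive_mod g (-1) J (\sum_(w <- ws) cword w).
Proof.
move=> /cancels_ker; have KK := tens_ker_subspace J.
have evalD ts ts' : terms_eval (ts ++ ts') = terms_eval ts + terms_eval ts'.
  exact: big_cat.
rewrite evalD => D.
have certK : tens_ker J (terms_eval (flatten (map line_terms cert))).
  elim: cert {D} => [|c cert IH] /=; first by rewrite /terms_eval big_nil; apply: subspace0.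
  by rewrite evalD; apply: (subspaceD KK) => //; apply: line_terms_ker.
have {D certK} := subspaceB KK D certK; rewrite addrK /primitive_mod => D.
pose h (f : talg F A) := comul g (-1) f - (tens f 1 + tens 1 f).
have lh : linear h.
  apply: sub_linear; first exact: comul_lin.
  apply: add_linear; last exact: tens_is_linear.
  by move=> a u v; apply: tens_linl.
rewrite -/(h _) (linear_sum_fun _ _ _ lh).
suff -> : \sum_(w <- ws) h (cword w) = terms_eval (flatten
    [seq word_comul w ++ [:: (true, (w, [::])); (true, ([::], w))] | w <- ws]) by [].
elim: ws {D} => [|w ws IH]; first by rewrite /terms_eval !big_nil.
rewrite big_cons IH /= 2!evalD; apply: (f_equal (fun d => d + _)).
rewrite /h word_comulE; apply: (f_equal (fun d => _ + d)).
have E2 t t' : terms_eval [:: t; t'] = term_eval t + term_eval t'.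
  by rewrite /terms_eval big_cons big_seq1.
have EN u v : term_eval (true, (u, v)) = - tens (cword u) (cword v).
  by rewrite /term_eval /= expr1 scaleN1r.
rewrite opprD; apply: etrans (esym (E2 _ _)).
apply: etrans (esym (f_equal2 +%R (EN _ _) (EN _ _))).
apply: (f_equal2 (fun d d' => - d - d')).
  exact: (f_equal (tens _) (word1 F A)).
exact: (f_equal (fun f : talg F A => tens f _) (word1 F A)).
Qed.

End FreeLetters.

(** * The quartic and the sextic relation *)

(** What is claimed of the quartic and of the sextic element. *)
Definition primitive_relation (F : fieldType) (A : finZmodType) (g : {perm A})
    (r : talg F A) : Prop :=
  [/\ nichols_ideal g (-1) r, Inn_homog_elt g r,
      primitive_mod g (-1) (J2 g (-1)) r
    & forall Q : set (talg F A),
        kerQ2 g (-1) `<=` Q -> Inn_homog_space g Q -> coideal g (-1) Q ->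
        let I := braided_ideal_gen g (-1)
                   (add_set Q [set a *: r | a in [set: F]]) in
        Inn_homog_space g I /\ coideal g (-1) I].

Section CertifiedRelations.
Variables (F : fieldType) (A : finZmodType) (g : {perm A}).
Hypothesis gD : {morph g : x y / x + y}.
Variables (M : zmodType) (G : M -> M) (e : M -> A) (base : A).
Hypothesis eD : {morph e : u v / u + v}.
Hypothesis eG : forall u, g (e u) = e (G u).
Variable n : nat.
Hypothesis norm0 : forall u, \sum_(i < n) iter i (fun v => - G v) u = 0.

Local Notation let_ := (letter e base).
Local Notation op := (code_op G).

Lemma letter_period a b :
  iter n (next_pair g) (let_ a, let_ b) = (let_ a, let_ b).
Proof.
have e0 := additive_fun0 eD.
have eN := additive_funN eD.
apply/eqP; rewrite iter_next_pair_id // /letter /= opprD addrACA subrr add0r -eN -eD.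
have := congr1 e (norm0 (a - b)); rewrite (big_morph e eD e0) e0 => <-.
apply/eqP/eq_bigr => i _; elim: (i : nat) => //= k ->.
by rewrite eG -eN.
Qed.

Lemma wdeg_letters w u :
  wdeg g (FMonom (map let_ w)) (let_ u) = let_ (foldr op u w).
Proof.
elim: w => [|x w IH]; first by rewrite /= /wdeg /= perm1.
by rewrite /= wdeg_cons permM IH phiE (letter_op base eD eG).
Qed.

(** The degree of a word is an affine map with linear part [g ^+ size w], so it
    suffices to compare two such maps at one point. *)
Lemma wdeg_letters_eq w w' : size w = size w' -> foldr op 0 w = foldr op 0 w' ->
  wdeg g (FMonom (map let_ w)) = wdeg g (FMonom (map let_ w')).
Proof.
move=> sw ww'; apply/permP => a.
apply: (addIr (- wdeg g (FMonom (map let_ w)) (let_ 0))).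
by rewrite wdeg_diff // wdeg_letters ww' -wdeg_letters wdeg_diff // !size_map sw.
Qed.

(** The code zero in the second condition is the point at which the degrees of
    the words are compared. *)
Theorem certified_relation w0 ws cert : (2 <= size w0)%N ->
  all (fun w => (size w == size w0) && (foldr op 0 w == foldr op 0 w0)) ws ->
  (let ts := primitivity_terms G n ws cert in cancels n (size ts) ts) ->
  let r : talg F A := \sum_(w <- ws) word F (map let_ w) in
  primitive_relation g r.
Proof.
move=> w02 /allP wsP ok r.
have pr : primitive_mod g (-1) (J2 g (-1)) r.
  exact: (primitive_certificate F gD eD eG letter_period ok).
have hr : homog_deg (size w0) r.
  rewrite /r big_seq; apply: (subspace_sum _ (homog_subspace F A (size w0))) => w.
  by case/wsP/andP => /eqP <- _; rewrite -(size_map let_); apply: homog_word.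
have Ir : Inn_homog_elt g r.
  exists (wdeg g (FMonom (map let_ w0))); first exact: wdeg_Inn.
  set p := wdeg _ _; have rp : inn_comp g p r = r.
    rewrite {1}/r (linear_sum_fun _ _ _ (inn_comp_lin g p)) /r.
    apply: eq_big_seq => w /wsP/andP[/eqP sw /eqP fw].
    by rewrite inn_comp_word (wdeg_letters_eq sw fw) eqxx.
  move=> w; rewrite -mcoeff_neq0 -rp wcomp_coef.
  by case: (wdeg g w =P p) => // _; rewrite eqxx.
have cr : counit r = 0.
  have l : linear (fun f : talg F A => counit f : F^o).
    by move=> a u v; rewrite counit_lin.
  rewrite /r (linear_sum_fun _ _ _ l) big1_seq // => w /wsP/andP[/eqP sw _].
  by rewrite counit_word; case: w sw w02 => //= <-.
split=> //; first exact: (primitive_nichols gD w02 hr pr).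
by move=> Q kQ hQ cQ; apply: adjoin_primitive.
Qed.

End CertifiedRelations.

Section QuarticRelation.
(** Coordinates with respect to [1], [g], [g^2] in [Z[g] / (1 - g + g^2 - g^3)]. *)
Definition code3 : Type := ((int * int) * int)%type.

Definition G3 (u : code3) : code3 := ((u.2, u.1.1 - u.2), u.1.2 + u.2).

Local Notation "a ▷ b" := (code_op G3 a b) (at level 40, left associativity).

Definition quartic_words (x y : code3) := [:: [:: x; y; x; y]; [:: y; x; y; x]].

(** The coefficients of [y] and of [yx] in the coproduct; exchanging [x] and [y]
    gives the other two.  The first is [x s - s c - xxd + dcc] for the orbit sum
    [s] of [(y, x)]. *)
Definition quartic_half (x y : code3) : seq (cert_line code3) :=
  let c := y ▷ x in let d := c ▷ y in
  [:: (false, [:: x], Cyc y x, [::], [:: y]);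
      (true, [::], Cyc y x, [:: c], [:: y]);
      (true, [::], Sq x, [:: d], [:: y]);
      (false, [:: d], Sq c, [::], [:: y]);
      (false, [::], Cyc y x, [::], [:: y; x])].

End QuarticRelation.


Section QuarticRelation.
Variables (F : fieldType) (A : finZmodType) (g : {perm A}).
Hypothesis gD : {morph g : x y / x + y}.

Lemma quartic_certified : let x : code3 := ((1, 0), 0) in let y : code3 := 0 in
  let ts := primitivity_terms G3 4 (quartic_words x y)
              (quartic_half x y ++ quartic_half y x) in
  cancels 4 (size ts) ts.
Proof. by vm_compute. Qed.

Definition eval3 (d : A) (u : code3) : A :=
  d *~ u.1.1 + g d *~ u.1.2 + g (g d) *~ u.2.

Theorem quartic_relation (x y : A) :
  (x - y) - g (x - y) + g (g (x - y)) - g (g (g (x - y))) = 0 ->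
  let X := gen F x in let Y := gen F y in
  let r := X * Y * X * Y + Y * X * Y * X in
  primitive_relation g r.
Proof.
have [d dE] : exists d, x - y = d by exists (x - y).
rewrite !dE => /subr0_eq dd X Y r.
have gZ := additive_funMz gD.
have eD : {morph eval3 d : u v / u + v}.
  by move=> u v; rewrite /eval3 /= !mulrzDr (AC (2 * 2 * 2) (1 * 3 * 5 * (2 * 4 * 6))).
have eG u : g (eval3 d u) = eval3 d (G3 u).
  rewrite /eval3 /G3 /= !gD !gZ -dd !mulrzDl !mulrzDr mulNrz mulrNz.
  by rewrite (AC (2 * 3) (3 * (1 * 4) * (2 * 5))).
have norm0 (u : code3) : \sum_(i < 4) iter i (fun v => - G3 v) u = 0.
  case: u => [[a b] c]; rewrite !big_ord_recl big_ord0 /=.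
  by apply: injective_projections; [apply: injective_projections|]; rewrite /=; ring.
(* Coordinates of the difference from [y]: those of [x] are [(1, 0, 0)]. *)
pose cx : code3 := ((1, 0), 0).
have lx : letter (eval3 d) y cx = x.
  by rewrite /letter /eval3 /= !mulr0z !addr0 mulr1z -dE addrC subrK.
have ly : letter (eval3 d) y 0 = y by rewrite /letter /eval3 /= !mulr0z !addr0.
have := certified_relation F gD y eD eG norm0 (w0 := [:: cx; 0; cx; 0])
  (isT : 2 <= 4)%N _ quartic_certified.
rewrite big_cons big_seq1 /= lx ly.
have gen4 (a b : A) : gen F a * gen F b * gen F a * gen F b = word F [:: a; b; a; b].
  by rewrite !wordM.
have -> : word F [:: x; y; x; y] + word F [:: y; x; y; x] = r.
  rewrite /r /X /Y; apply: (f_equal2 +%R).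
    exact: esym (gen4 x y).
  exact: esym (gen4 y x).
apply; by vm_compute.
Qed.

End QuarticRelation.

Section SexticRelation.

(** Coordinates with respect to [1], [g] in [Z[g] / (1 - g + g^2)], for each of the
    differences [x - z] and [y - z]. *)
Definition code2 : Type := (int * int)%type.
Definition code4 : Type := (code2 * code2)%type.

Definition G2 (u : code2) : code2 := (- u.2, u.1 + u.2).
Definition G4 (u : code4) : code4 := (G2 u.1, G2 u.2).

Local Notation "a ▷ b" := (code_op G4 a b) (at level 40, left associativity).

Definition sextic_words (x y z : code4) :=
  [:: [:: x; y; z; x; y; z]; [:: y; z; x; y; z; x]; [:: z; x; y; z; x; y]].

(** The coefficients of [x], [xy], [yx], [xyx], [xyz], [xzy], [xyxz], [xyzx] and
    [xyzy] in the coproduct; the cyclic permutations of [x], [y], [z] give all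
    others up to braid moves of the right factor.  In the coefficient of [x],

      [- y'z'xy'z' + xyzy'z' - yzy'z'x + yzxyz + zy'z'xy' - zxyzy'],

    the six orbit sums move [x] out of the words, which leaves
    [- yy'zy'z' + y'zz'y'z' - yzyy'z + yzy'zz' + zyy'zy' - zy'zz'y'], and the five
    braid relations between [y], [z], [y'], [z'] reduce this to zero. *)
Definition sextic_third (x y z : code4) : seq (cert_line code4) :=
  let y' := x ▷ y in let z' := x ▷ z in
  let w := y ▷ z in let w' := x ▷ w in
  let t := y' ▷ z in
  [:: (true, [:: y'], Cyc x z, [:: y'; z'], [:: x]);
      (false, [::], Cyc x y, [:: z; y'; z'], [:: x]);
      (true, [:: y; z; y'], Cyc x z, [::], [:: x]);
      (false, [:: y; z], Cyc x y, [:: z], [:: x]);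
      (false, [:: z; y'], Cyc x z, [:: y'], [:: x]);
      (true, [:: z], Cyc x y, [:: z; y'], [:: x]);
      (true, [:: y], Brd y' z, [:: z'], [:: x]);
      (false, [:: z; y], Brd y' z, [::], [:: x]);
      (true, [::], Brd y z, [:: y'; z], [:: x]);
      (false, [::], Brd y' z, [:: z'; y'], [:: x]);
      (true, [:: y'; z], Brd y' z', [::], [:: x]);

      (true, [::], Cyc z' w', [:: x; w'], [:: x; y]);
      (false, [:: w'], Cyc y y', [:: w'], [:: x; y]);
      (true, [:: z], Cyc z' w', [:: x], [:: x; y]);
      (false, [:: z; w'], Cyc y y', [::], [:: x; y]);
      (false, [:: z'], Brd w' x, [::], [:: x; y]);
      (false, [::], Cyc z z', [:: w'; x], [:: x; y]);
      (true, [:: x; z], Cyc w w', [::], [:: x; y]);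
      (false, [:: x], Cyc z w, [:: w'], [:: x; y]);
      (true, [::], Brd z x, [:: w], [:: x; y]);
      (false, [:: z; x], Cyc z w, [::], [:: x; y]);
      (true, [::], Cyc w w', [:: y; w'], [:: x; y]);
      (true, [:: z], Cyc w w', [:: y], [:: x; y]);
      (false, [::], Cyc z w, [:: w'; y], [:: x; y]);
      (true, [:: w], Brd y w', [::], [:: x; y]);

      (false, [:: z], Brd w x, [::], [:: y; x]);
      (true, [::], Cyc z w, [:: x; w], [:: y; x]);
      (false, [:: w], Cyc y x, [:: w], [:: y; x]);
      (true, [:: w; x], Cyc w (y ▷ z'), [::], [:: y; x]);
      (false, [::], Brd w x, [:: y ▷ z'], [:: y; x]);

      (true, [:: z], Cyc w w', [::], [:: x; y; x]);
      (false, [::], Cyc z w, [:: w'], [:: x; y; x]);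
      (false, [::], Cyc w w', [:: (z ▷ x) ▷ w], [:: x; y; x]);
      (true, [:: w], Cyc y w', [::], [:: x; y; x]);

      (false, [::], Cyc t y', [:: z'], [:: x; y; z]);
      (true, [:: t], Cyc z' w', [::], [:: x; y; z]);
      (true, [:: y'], Cyc z z', [::], [:: x; y; z]);
      (false, [::], Cyc t w', [:: y'], [:: x; y; z]);
      (true, [:: y], Cyc t y', [::], [:: x; y; z]);
      (false, [::], Cyc y y', [:: z], [:: x; y; z]);

      (true, [::], Brd z y', [::], [:: x; z; y]);

      (true, [::], Cyc w w', [::], [:: x; y; x; z]);
      (false, [::], Cyc z w, [::], [:: x; y; z; x]);
      (true, [::], Cyc t y', [::], [:: x; y; z; y])].

Lemma sextic_certified :
  let x : code4 := ((1, 0), 0) in let y : code4 := (0, (1, 0)) in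
  let z : code4 := 0 in
  let ts := primitivity_terms G4 3 (sextic_words x y z)
    (sextic_third x y z ++ sextic_third y z x ++ sextic_third z x y) in
  cancels 3 (size ts) ts.
Proof. by vm_compute. Qed.


Variables (F : fieldType) (A : finZmodType) (g : {perm A}).
Hypothesis gD : {morph g : x y / x + y}.

Definition eval2 (d : A) (u : code2) : A := d *~ u.1 + g d *~ u.2.

Definition eval4 (d d' : A) (u : code4) : A := eval2 d u.1 + eval2 d' u.2.

Theorem sextic_relation (x y z : A) :
  (x - z) - g (x - z) + g (g (x - z)) = 0 ->
  (y - z) - g (y - z) + g (g (y - z)) = 0 ->
  let X := gen F x in let Y := gen F y in let Z := gen F z in
  let r := X * Y * Z * X * Y * Z + Y * Z * X * Y * Z * X
           + Z * X * Y * Z * X * Y in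
  primitive_relation g r.
Proof.
have [d dE] : exists d, x - z = d by exists (x - z).
have [d' d'E] : exists d', y - z = d' by exists (y - z).
rewrite !dE !d'E => dd dd' X Y Z r.
have gZ := additive_funMz gD.
have eD1 c : {morph eval2 c : u v / u + v}.
  by move=> u v; rewrite /eval2 /= !mulrzDr addrACA.
have eG1 c : c - g c + g (g c) = 0 -> forall u, g (eval2 c u) = eval2 c (G2 u).
  move=> cc u; have ggc : g (g c) = g c - c.
    by apply/eqP; rewrite -[g c - c]opprB -addr_eq0 addrC cc.
  rewrite /eval2 /G2 /= gD !gZ ggc mulrzBl mulrzDr mulrNz.
  by rewrite (AC (1 * 2) (3 * (1 * 2))).
have eD : {morph eval4 d d' : u v / u + v}.
  by move=> u v; rewrite /eval4 /= !eD1 addrACA.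
have eG u : g (eval4 d d' u) = eval4 d d' (G4 u).
  by rewrite /eval4 gD !eG1.
have norm0 (u : code4) : \sum_(i < 3) iter i (fun v => - G4 v) u = 0.
  case: u => [[a b] [a' b']]; rewrite !big_ord_recl big_ord0 /=.
  by apply: injective_projections; apply: injective_projections; rewrite /=; ring.
pose cx : code4 := ((1, 0), 0); pose cy : code4 := (0, (1, 0)).
have lx : letter (eval4 d d') z cx = x.
  by rewrite /letter /eval4 /eval2 /= !mulr0z !addr0 mulr1z -dE addrC subrK.
have ly : letter (eval4 d d') z cy = y.
  by rewrite /letter /eval4 /eval2 /= !mulr0z !(addr0, add0r) mulr1z -d'E addrC subrK.
have lz : letter (eval4 d d') z 0 = z.
  by rewrite /letter /eval4 /eval2 /= !mulr0z !addr0.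
have := certified_relation F gD z eD eG norm0 (w0 := [:: cx; cy; 0; cx; cy; 0])
  (isT : 2 <= 6)%N _ sextic_certified.
rewrite big_cons big_cons big_seq1 /= lx ly lz.
have gen6 (a b c : A) : gen F a * gen F b * gen F c * gen F a * gen F b * gen F c =
    word F [:: a; b; c; a; b; c].
  by rewrite !wordM.
have -> : word F [:: x; y; z; x; y; z] +
    (word F [:: y; z; x; y; z; x] + word F [:: z; x; y; z; x; y]) = r.
  rewrite /r /X /Y /Z; apply: (etrans (addrA _ _ _)).
  apply: (f_equal2 +%R); last exact: esym (gen6 z x y).
  by apply: (f_equal2 +%R); [apply: esym (gen6 x y z) | apply: esym (gen6 y z x)].
apply; by vm_compute.
Qed.

End SexticRelation.

Local Open Scope complex_scope.

Theorem lemma6p12 (R : realType) (A : finZmodType) (g : {perm A})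
    (g_aut : g \in Aut [set: A]%SET) :
  (* (1) *)
  [/\ forall p : A * A, nichols_ideal g (-1) (chain R[i] g p),
      is_basis (nichols_rel2 g (-1)) (undup [seq chain R[i] g p | p : A * A]),
      equivalence_rel (chain_rel g)
    & has_dim (@nichols_rel2 R[i] A g (-1))
        #|chain_classes g [set: A * A]%SET| ]
  /\
  (* (2) *)
  (forall (q : R[i]) (l : nat), l.-primitive_root (- q) ->
    let D := [set p : A * A | (l %| chain_len g (p.1 - p.2)%R)%N]%SET in
    (forall p, p \in D -> nichols_rel2 g q (qchain g q p)) /\
    (forall X : {set A * A}, is_transversal X (chain_classes g D) D ->
      is_basis (nichols_rel2 g q) [seq qchain g q p | p <- enum X]))
  /\
  (* (3) *)
  (forall x y : A,
    (x - y) - g (x - y) + g (g (x - y)) - g (g (g (x - y))) = 0 ->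
    let X := gen R[i] x in let Y := gen R[i] y in
    let r := X * Y * X * Y + Y * X * Y * X in
    [/\ nichols_ideal g (-1) r,
        Inn_homog_elt g r,
        primitive_mod g (-1) (J2 g (-1)) r
      & forall Q : set (talg R[i] A),
          kerQ2 g (-1) `<=` Q -> Inn_homog_space g Q -> coideal g (-1) Q ->
          let I := braided_ideal_gen g (-1)
                     (add_set Q [set a *: r | a in [set: R[i]]]) in
          Inn_homog_space g I /\ coideal g (-1) I])
  /\
  (* (4) *)
  (forall x y z : A,
    (x - z) - g (x - z) + g (g (x - z)) = 0 ->
    (y - z) - g (y - z) + g (g (y - z)) = 0 ->
    let X := gen R[i] x in let Y := gen R[i] y in let Z := gen R[i] z in
    let r := X * Y * Z * X * Y * Z + Y * Z * X * Y * Z * X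
             + Z * X * Y * Z * X * Y in
    [/\ nichols_ideal g (-1) r,
        Inn_homog_elt g r,
        primitive_mod g (-1) (J2 g (-1)) r
      & forall Q : set (talg R[i] A),
          kerQ2 g (-1) `<=` Q -> Inn_homog_space g Q -> coideal g (-1) Q ->
          let I := braided_ideal_gen g (-1)
                     (add_set Q [set a *: r | a in [set: R[i]]]) in
          Inn_homog_space g I /\ coideal g (-1) I]).
Proof.
have gD : {morph g : x y / x + y}.
  by move=> x y; apply: (morphicP (Aut_morphic g_aut)); rewrite inE.
split; [|split; [|split]].
- have [basis dim] := chain_basis R[i] gD; split=> // [p|].
    exact: (chain_rel2 R[i] gD p).2.
  exact: chain_rel_equiv.
- move=> q l lq D; have DE p :
      (p \in D) = ((- q) ^+ fingraph.order (next_pair g) p == 1).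
    by rewrite inE chain_lenE // (prim_order_dvd lq).
  split=> [p|X]; last exact: qchain_basis.
  by rewrite DE => /eqP; apply: qchain_rel2.
- exact: quartic_relation.
exact: sextic_relation.
Qed.
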